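(* Let $\mathsf{Ctx}$ be the category of contexts for a functional language $\mathbb{F}$, and let $\mathbf{P}_0$ be a quantifier-free fragment of a first-order Boolean doctrine $\mathbf{P}\colon\mathsf{Ctx}^{\mathrm{op}}\to\mathsf{BA}$. Then there are a relational language $\mathbb{P}$ (a set of predicate symbols with arities), a theory $\mathcal{T}$ in the first-order language $(\mathbb{F},\mathbb{P})$, and a first-order Boolean doctrine isomorphism between $\mathbf{P}$ and $\mathsf{LT}^{\mathcal{T}}$ under which $\mathbf{P}_0$ corresponds to $\mathsf{LT}^{\mathcal{T}}_0$, the subfunctor of $\mathsf{LT}^{\mathcal{T}}$ of quantifier-free formulas modulo $\mathcal{T}$.
   Context: $\mathsf{BA}$ is the category of Boolean algebras and Boolean homomorphisms. A Boolean doctrine over a category $\mathsf{C}$ with finite products is a functor $\mathbf{P}\colon\mathsf{C}^{\mathrm{op}}\to\mathsf{BA}$; it is a first-order Boolean doctrine if (i) for all $X,Y\in\mathsf{C}$ the map $\mathbf{P}(\mathrm{pr}_1)\colon\mathbf{P}(X)\to\mathbf{P}(X\times Y)$ has a right adjoint $(\forall Y)_X$ (as an order-preserving map); and (ii) for every $f\colon X'\to X$ and every $Y$, $\mathbf{P}(f)\circ(\forall Y)_X=(\forall Y)_{X'}\circ\mathbf{P}(f\times\mathrm{id}_Y)$. A first-order Boolean doctrine morphism from $\mathbf{P}\colon\mathsf{C}^{\mathrm{op}}\to\mathsf{BA}$ to $\mathbf{R}\colon\mathsf{D}^{\mathrm{op}}\to\mathsf{BA}$ is a pair $(M,\mathfrak{m})$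 with $M\colon\mathsf{C}\to\mathsf{D}$ a finite-product-preserving functor and $\mathfrak{m}\colon\mathbf{P}\to\mathbf{R}\circ M^{\mathrm{op}}$ a natural transformation such that $\mathfrak{m}_X\circ(\forall Y)_X=(\forall M(Y))_{M(X)}\circ\mathfrak{m}_{X\times Y}$ for all $X,Y$. A quantifier-free fragment of a first-order Boolean doctrine $\mathbf{P}\colon\mathsf{C}^{\mathrm{op}}\to\mathsf{BA}$ is a subfunctor $\mathbf{P}_0$ of $\mathbf{P}$ (each $\mathbf{P}_0(X)$ a Boolean subalgebra of $\mathbf{P}(X)$, closed under reindexing) such that, for each $X$, $\mathbf{P}(X)=\bigcup_{n\in\mathbb{N}}\mathbf{P}_n(X)$, where, inductively, $\mathbf{P}_{n+1}(X)$ is the Boolean subalgebra of $\mathbf{P}(X)$ generated by the union, over all objects $Y$, of the images of $\mathbf{P}_n(X\times Y)$ under $(\forall Y)_X$. Syntax. A first-order language $(\mathbb{F},\mathbb{P})$ (without equality) has function symbols $\mathbb{F}$ and predicate symbols $\mathbb{P}$. Formulas are considered up to renaming of bound variables. A context is a finite list of distinct variables; $\alpha:\vec x$ means that the free variables of $\alpha$ are among $\vec x$. A theory is a set of closed formulas. $\mathsf{Ctx}$, the category of contexts for $\mathbb{F}$, has contexts as objects; a morphism $(x_1,\dots,x_n)\to(y_1,\dots,y_m)$ is an $m$-tuple of $\mathbb{F}$-terms with variables among $\vec x$; composition is simultaneous substitution. It has finite products (concatenation of contexts after renaming; the terminal object is the empty list $()$). Provability: sequents $\Gamma\Rightarrow_{\vec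 y}\Delta$ carry a context $\vec y$, with $\Gamma,\Delta$ finite lists of formulas in context $\vec y$. The rules are those of the classical sequent calculus (identity, weakening, contraction, exchange, cut, left/right rules for $\top,\bot,\land,\lor,\lnot,\to$), all within one fixed context, together with: context enlargement (from $\Gamma\Rightarrow_{\vec y}\Delta$ infer $\Gamma\Rightarrow_{(\vec y,x)}\Delta$, $x\notin\vec y$); (L$\forall$) from $\zeta[t/x],\Gamma\Rightarrow_{\vec y}\Delta$ infer $\forall x\,\zeta,\Gamma\Rightarrow_{\vec y}\Delta$, where $t$ is a term with variables in $\vec y$; (R$\forall$) from $\Gamma\Rightarrow_{(\vec y,x)}\Delta,\zeta$ infer $\Gamma\Rightarrow_{\vec y}\Delta,\forall x\,\zeta$, where $\Gamma,\Delta$ are in context $\vec y$ and $x\notin\vec y$; and the dual rules (L$\exists$), (R$\exists$). (So the empty structure is admitted as a model.) A sequent is provable from $\mathcal{T}$ if it is derivable with additional axioms $\Rightarrow_{()}\varphi$ for $\varphi\in\mathcal{T}$. The syntactic doctrine $\mathsf{LT}^{\mathcal{T}}\colon\mathsf{Ctx}^{\mathrm{op}}\to\mathsf{BA}$: $\mathsf{LT}^{\mathcal{T}}(\vec x)$ is the poset reflection of the set of formulas in context $\vec x$ preordered by: $\alpha$ below $\beta$ iff $\alpha\Rightarrow_{\vec x}\beta$ is provable from $\mathcal{T}$; reindexing is substitution. It is a first-order Boolean doctrine with $(\forall\vec y)_{\vec x}=\forall y_1\cdots\forall y_m$. $\mathsf{LT}^{\mathcal{T}}_0(\vec x)\subseteq\mathsf{LT}^{\mathcal{T}}(\vec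 x)$ is the set of equivalence classes of quantifier-free formulas in context $\vec x$. *)

(* Defs.v *)
From HB Require Import structures.
From mathcomp Require Import all_boot all_order.
From mathcomp Require Import boolp classical_sets.
From mathcomp Require Import generic_quotient.

Set Implicit Arguments.
Unset Strict Implicit.
Unset Printing Implicit Defensive.

Import Order.Theory.

Local Open Scope quotient_scope.
Local Open Scope classical_set_scope.

Record category := Category {
  ob :> Type;
  hom : ob -> ob -> Type;
  idm : forall X, hom X X;
  compm : forall X Y Z, hom Y Z -> hom X Y -> hom X Z;
  comp1m : forall X Y (f : hom X Y), compm (idm Y) f = f;
  compm1 : forall X Y (f : hom X Y), compm f (idm X) = f;
  compmA : forall X Y Z W (h : hom Z W) (g : hom Y Z) (f : hom X Y),
    compm h (compm g f) = compm (compm h g) f }.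

Notation "g \oc f" := (compm g f) (at level 50, left associativity).

Definition is_terminal (C : category) (T : C) : Prop :=
  forall Z : C, exists! f : hom Z T, True.

Definition is_product (C : category) (X Y Z : C)
    (p1 : hom Z X) (p2 : hom Z Y) : Prop :=
  forall (W : C) (f : hom W X) (g : hom W Y),
    exists! h : hom W Z, p1 \oc h = f /\ p2 \oc h = g.

(* Finite products are chosen; the notions below are independent of the
   choice. *)
Record category_fp := CategoryFP {
  fp_cat :> category;
  term_ob : fp_cat;
  bang : forall X, hom X term_ob;
  bang_uniq : forall X (f : hom X term_ob), f = bang X;
  prod_ob : fp_cat -> fp_cat -> fp_cat;
  pr1 : forall X Y, hom (prod_ob X Y) X;
  pr2 : forall X Y, hom (prod_ob X Y) Y;
  pairm : forall X Y Z, hom Z X -> hom Z Y -> hom Z (prod_ob X Y);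
  pr1_pair : forall X Y Z (f : hom Z X) (g : hom Z Y),
    pr1 X Y \oc pairm f g = f;
  pr2_pair : forall X Y Z (f : hom Z X) (g : hom Z Y),
    pr2 X Y \oc pairm f g = g;
  pair_uniq : forall X Y Z (h : hom Z (prod_ob X Y)),
    h = pairm (pr1 X Y \oc h) (pr2 X Y \oc h) }.

Arguments pr1 {c} X Y.
Arguments pr2 {c} X Y.
Arguments term_ob {c}.

Notation "X \x Y" := (prod_ob X Y) (at level 40, left associativity).

Definition prod_id (C : category_fp) (X' X Y : C) (f : hom X' X) :
    hom (X' \x Y) (X \x Y) :=
  pairm (f \oc pr1 X' Y) (pr2 X' Y).

Record functor (C D : category) := Functor {
  fob :> C -> D;
  fmap : forall X Y, hom X Y -> hom (fob X) (fob Y);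
  fmap1 : forall X, fmap (idm X) = idm (fob X);
  fmapM : forall X Y Z (g : hom Y Z) (f : hom X Y),
    fmap (g \oc f) = fmap g \oc fmap f }.

Definition functor_id (C : category) : functor C C :=
  @Functor C C id (fun _ _ f => f) (fun=> erefl) (fun _ _ _ _ _ => erefl).

Lemma functor_comp1 (C D E : category) (G : functor D E) (F : functor C D) X :
  fmap G (fmap F (idm X)) = idm (G (F X)).
Proof. by rewrite !fmap1. Qed.

Lemma functor_compM (C D E : category) (G : functor D E) (F : functor C D)
    X Y Z (g : hom Y Z) (f : hom X Y) :
  fmap G (fmap F (g \oc f)) = fmap G (fmap F g) \oc fmap G (fmap F f).
Proof. by rewrite !fmapM. Qed.

Definition functor_comp (C D E : category) (G : functor D E) (F : functor C D) :
    functor C E :=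
  @Functor C E (fun X => G (F X)) (fun _ _ f => fmap G (fmap F f))
    (functor_comp1 G F) (functor_compM G F).

Definition preserves_fp (C D : category_fp) (M : functor C D) : Prop :=
  is_terminal (M term_ob) /\
  forall X Y : C, is_product (fmap M (pr1 X Y)) (fmap M (pr2 X Y)).

(* [Order.TBLatticeMorphism] only asks for preservation of [\bot] and [\top],
   so the library has no ready-made type of Boolean homomorphisms. *)
Record boolHom d d' (A : ctbDistrLatticeType d) (B : ctbDistrLatticeType d') :=
  BoolHom {
    bhom :> A -> B;
    bhomI : Order.meet_morphism bhom;
    bhomU : Order.join_morphism bhom;
    bhom0 : bhom \bot%O = \bot%O;
    bhom1 : bhom \top%O = \top%O;
    bhomC : {morph bhom : x / (~` x)%O} }.

Lemma boolHom_eq d d' (A : ctbDistrLatticeType d) (B : ctbDistrLatticeType d')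
  (f g : boolHom A B) : f =1 g -> f = g.
Proof.
case: f g => f a1 a2 a3 a4 a5 [g b1 b2 b3 b4 b5] /= /funext fg.
by case: _ / fg in b1 b2 b3 b4 b5 *; congr BoolHom.
Qed.

Definition boolHom_id d (A : ctbDistrLatticeType d) : boolHom A A :=
  @BoolHom d d A A id (fun _ _ => erefl) (fun _ _ => erefl) erefl erefl
    (fun=> erefl).

Section BoolHomComp.
Variables (d d' d'' : Order.disp_t) (A : ctbDistrLatticeType d).
Variables (B : ctbDistrLatticeType d') (C : ctbDistrLatticeType d'').
Variables (g : boolHom B C) (f : boolHom A B).

Fact boolHom_compI : Order.meet_morphism (fun x => g (f x)).
Proof. by move=> x y; rewrite !bhomI. Qed.
Fact boolHom_compU : Order.join_morphism (fun x => g (f x)).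
Proof. by move=> x y; rewrite !bhomU. Qed.
Fact boolHom_comp0 : g (f \bot%O) = \bot%O. Proof. by rewrite !bhom0. Qed.
Fact boolHom_comp1 : g (f \top%O) = \top%O. Proof. by rewrite !bhom1. Qed.
Fact boolHom_compC : {morph (fun x => g (f x)) : x / (~` x)%O}.
Proof. by move=> x; rewrite !bhomC. Qed.

Definition boolHom_comp : boolHom A C :=
  BoolHom boolHom_compI boolHom_compU boolHom_comp0 boolHom_comp1 boolHom_compC.
End BoolHomComp.

Record boolean_doctrine (d : Order.disp_t) (C : category_fp) :=
  BooleanDoctrine {
    dob :> C -> ctbDistrLatticeType d;
    dmap : forall X Y : C, hom X Y -> boolHom (dob Y) (dob X);
    dmap1 : forall X (a : dob X), dmap (idm X) a = a;
    dmapM : forall X Y Z (g : hom Y Z) (f : hom X Y) (a : dob Z),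
      dmap (g \oc f) a = dmap f (dmap g a) }.

(* Adjoints between posets are unique, so the operation [fall] is not
   additional structure; its monotonicity follows from [fall_adj]. *)
Record fo_doctrine (d : Order.disp_t) (C : category_fp) := FoDoctrine {
  fo_doc :> boolean_doctrine d C;
  fall : forall X Y : C, fo_doc (X \x Y) -> fo_doc X;
  fall_adj : forall X Y (a : fo_doc X) (b : fo_doc (X \x Y)),
    (dmap fo_doc (pr1 X Y) a <= b)%O = (a <= fall b)%O;
  fall_BC : forall X X' Y (f : hom X' X) (b : fo_doc (X \x Y)),
    dmap fo_doc f (fall b) = fall (dmap fo_doc (prod_id Y f) b) }.

Arguments fall {d C} _ {X Y} _.

Record doctrine_morphism d d' (C D : category_fp)
    (P : boolean_doctrine d C) (R : boolean_doctrine d' D) :=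
  DoctrineMorphism {
    dm_fun : functor C D;
    dm_nat :> forall X : C, boolHom (P X) (R (dm_fun X));
    dm_natural : forall (X Y : C) (f : hom X Y) (a : P Y),
      dm_nat X (dmap P f a) = dmap R (fmap dm_fun f) (dm_nat Y a) }.

Definition doctrine_id d (C : category_fp) (P : boolean_doctrine d C) :
    doctrine_morphism P P :=
  @DoctrineMorphism d d C C P P (functor_id C) (fun X => boolHom_id (P X))
    (fun _ _ _ _ => erefl).

Section DoctrineComp.
Variables (d d' d'' : Order.disp_t) (C D E : category_fp).
Variables (P : boolean_doctrine d C) (R : boolean_doctrine d' D).
Variables (S : boolean_doctrine d'' E).
Variables (n : doctrine_morphism R S) (m : doctrine_morphism P R).

Fact doctrine_comp_natural (X Y : C) (f : hom X Y) (a : P Y) :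
  n _ (m X (dmap P f a)) =
  dmap S (fmap (dm_fun n) (fmap (dm_fun m) f)) (n _ (m Y a)).
Proof. by rewrite !dm_natural. Qed.

Definition doctrine_comp : doctrine_morphism P S :=
  @DoctrineMorphism d d'' C E P S (functor_comp (dm_fun n) (dm_fun m))
    (fun X => boolHom_comp (n (dm_fun m X)) (m X)) doctrine_comp_natural.
End DoctrineComp.

(* The identity m (forall a) = forall (m a) is read along the identification
   of M X \x M Y with M (X \x Y): as M preserves products, there is exactly one
   [u] satisfying the two hypotheses of [fom_fall], namely the inverse of the
   comparison morphism (M pr1, M pr2). *)
Record fo_morphism d d' (C D : category_fp)
    (P : fo_doctrine d C) (R : fo_doctrine d' D) := FoMorphism {
  fom :> doctrine_morphism P R;
  fom_fp : preserves_fp (dm_fun fom);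
  fom_fall : forall (X Y : C) (a : P (X \x Y))
      (u : hom (dm_fun fom X \x dm_fun fom Y) (dm_fun fom (X \x Y))),
    fmap (dm_fun fom) (pr1 X Y) \oc u = pr1 _ _ ->
    fmap (dm_fun fom) (pr2 X Y) \oc u = pr2 _ _ ->
    fom X (fall P a) = fall R (dmap R u (fom (X \x Y) a)) }.

Definition is_fo_isomorphism d d' (C D : category_fp)
    (P : fo_doctrine d C) (R : fo_doctrine d' D) (m : fo_morphism P R) : Prop :=
  exists n : fo_morphism R P,
    doctrine_comp n m = doctrine_id P /\ doctrine_comp m n = doctrine_id R.

Record boolean_subalgebra d (A : ctbDistrLatticeType d) (S : set A) : Prop :=
  BooleanSubalgebra {
    subalg0 : S \bot%O;
    subalg1 : S \top%O;
    subalgI : forall x y, S x -> S y -> S (x `&` y)%O;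
    subalgU : forall x y, S x -> S y -> S (x `|` y)%O;
    subalgC : forall x, S x -> S (~` x)%O }.

Fixpoint qa_stratum d (C : category_fp) (P : fo_doctrine d C)
    (P0 : forall X : C, set (P X)) (n : nat) (X : C) : set (P X) :=
  if n is n'.+1 then
    smallest (@boolean_subalgebra d (P X))
      (\bigcup_(Y in [set: C]) (fall P @` @qa_stratum d C P P0 n' (X \x Y)))
  else P0 X.

Arguments qa_stratum {d C P} P0 n X.

Record qf_fragment d (C : category_fp) (P : fo_doctrine d C)
    (P0 : forall X : C, set (P X)) : Prop := QfFragment {
  qff_subalg : forall X, boolean_subalgebra (P0 X);
  qff_reindex : forall (X Y : C) (f : hom X Y) (a : P Y),
    P0 Y a -> P0 X (dmap P f a);
  qff_cover : forall X, [set: P X] = \bigcup_n qa_stratum P0 n X }.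

Record language := Language { symb :> Type; arity : symb -> nat }.

Inductive term (F : language) (V : Type) : Type :=
| Var of V
| App (f : F) of ('I_(arity f) -> term F V).

Arguments Var {F V}.
Arguments App {F V}.

Fixpoint tsubst F (V W : Type) (s : V -> term F W) (t : term F V) : term F W :=
  match t with
  | Var v => s v
  | App f ts => App f (fun i => tsubst s (ts i))
  end.

(* Formulas with free variables in [V], up to renaming of bound variables:
   the body of a quantifier has one more free variable [None], which is the one
   being bound. *)
Inductive form (F R : language) (V : Type) : Type :=
| Atom (p : R) of ('I_(arity p) -> term F V)
| Top
| Bot
| And of form F R V & form F R V
| Or of form F R V & form F R V
| Imp of form F R V & form F R V
| Not of form F R V
| All of form F R (option V)
| Ex of form F R (option V).

Arguments Atom {F R V}.
Arguments Top {F R V}.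
Arguments Bot {F R V}.

Fixpoint qfree F R (V : Type) (a : form F R V) : bool :=
  match a with
  | Atom _ _ | Top | Bot => true
  | And a b | Or a b | Imp a b => qfree a && qfree b
  | Not a => qfree a
  | All _ | Ex _ => false
  end.

Definition slift F (V W : Type) (s : V -> term F W) (o : option V) : term F (option W) :=
  if o is Some v then tsubst (fun w => Var (Some w)) (s v) else Var None.

Fixpoint fsubst F R (V W : Type) (s : V -> term F W) (a : form F R V) : form F R W :=
  match a with
  | Atom p ts => Atom p (fun i => tsubst s (ts i))
  | Top => Top
  | Bot => Bot
  | And a b => And (fsubst s a) (fsubst s b)
  | Or a b => Or (fsubst s a) (fsubst s b)
  | Imp a b => Imp (fsubst s a) (fsubst s b)
  | Not a => Not (fsubst s a)
  | All a => All (fsubst (slift s) a)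
  | Ex a => Ex (fsubst (slift s) a)
  end.

Definition frename F R (V W : Type) (r : V -> W) (a : form F R V) : form F R W :=
  fsubst (fun v => @Var F W (r v)) a.

Section SubstTheory.
Variables F R : language.

Lemma tsubst_var V (t : term F V) : tsubst Var t = t.
Proof. by elim: t => [//|f ts IH] /=; congr App; apply/funext => i. Qed.

Lemma tsubst_tsubst V W Z (s : V -> term F W) (r : W -> term F Z) t :
  tsubst r (tsubst s t) = tsubst (fun v => tsubst r (s v)) t.
Proof. by elim: t => [//|f ts IH] /=; congr App; apply/funext => i. Qed.

Lemma slift_var V : slift (@Var F V) = Var.
Proof. by apply/funext; case. Qed.

Lemma slift_comp V W Z (s : V -> term F W) (r : W -> term F Z) :
  (fun o => tsubst (slift r) (slift s o)) = slift (fun v => tsubst r (s v)).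
Proof. by apply/funext; case => [v|] //=; rewrite !tsubst_tsubst. Qed.

Lemma fsubst_var V (a : form F R V) : fsubst Var a = a.
Proof.
elim: V / a => [V p ts|V|V|V a IHa b IHb|V a IHa b IHb|V a IHa b IHb
  |V a IHa|V a IHa|V a IHa] //=; rewrite ?slift_var ?IHa ?IHb //.
by congr Atom; apply/funext => i; rewrite tsubst_var.
Qed.

Lemma fsubst_fsubst V W Z (s : V -> term F W) (r : W -> term F Z)
    (a : form F R V) :
  fsubst r (fsubst s a) = fsubst (fun v => tsubst r (s v)) a.
Proof.
elim: V / a W Z s r => [V p ts|V|V|V a IHa b IHb|V a IHa b IHb|V a IHa b IHb
  |V a IHa|V a IHa|V a IHa] W Z s r //=; rewrite ?IHa ?IHb ?slift_comp //.
by congr Atom; apply/funext => i; rewrite tsubst_tsubst.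
Qed.

End SubstTheory.

(* The set of variables is [nat]; [c] is a finite list of distinct variables. *)
Record ctx := MkCtx { names :> seq nat; names_uniq : uniq names }.

Definition vars (s : seq nat) : Type := {v : nat | v \in s}.

Lemma vars_nilF (v : vars [::]) : False.
Proof. by case: v. Qed.

Definition ctx0 : ctx := @MkCtx [::] isT.

Fact ext_uniq (c : ctx) (x : nat) : x \notin (c : seq nat) -> uniq (rcons c x).
Proof. by move=> xc; rewrite rcons_uniq xc names_uniq. Qed.

Definition ext (c : ctx) (x : nat) (xc : x \notin (c : seq nat)) : ctx :=
  MkCtx (ext_uniq xc).

(* The formulas whose free variables are among those of [c]. They are typed by
   their context, so context enlargement acts by the inclusion [weaken]. *)
Notation cterm F c := (term F (vars c)).
Notation cform F R c := (form F R (vars c)).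

Fact vincl_in (s : seq nat) (x : nat) (v : vars s) : val v \in rcons s x.
Proof. by rewrite mem_rcons inE (valP v) orbT. Qed.

Definition vincl (s : seq nat) (x : nat) (v : vars s) : vars (rcons s x) :=
  exist _ (val v) (vincl_in x v).

(* [None] for the variables of [s'] that are not in [s]. *)
Definition vbind (s s' : seq nat) (v : vars s') : option (vars s) :=
  insub (val v).

Definition weaken F R (s : seq nat) (x : nat) (a : cform F R s) :
    cform F R (rcons s x) :=
  frename (@vincl s x) a.

Section NamedQuantifiers.
Variables (F R : language) (c : ctx) (x : nat) (xc : x \notin (c : seq nat)).

Definition forall_x (a : cform F R (ext xc)) : cform F R c :=
  All (frename (@vbind c _) a).

Definition exists_x (a : cform F R (ext xc)) : cform F R c :=
  Ex (frename (@vbind c _) a).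

(* The substitution a[t/x], where [None] is the case of the variable x. *)
Definition inst_x (t : cterm F c) (a : cform F R (ext xc)) : cform F R c :=
  fsubst (fun v => if vbind c v is Some w then Var w else t) a.

End NamedQuantifiers.

Definition bind_hd V (x : nat) (s : seq nat) (v : V + vars (x :: s)) :
    option V + vars s :=
  match v with
  | inl u => inl (Some u)
  | inr w => if vbind s w is Some w' then inr w' else inl None
  end.

Definition bind_nil V (v : V + vars [::]) : V :=
  match v with inl u => u | inr w => False_rect V (vars_nilF w) end.

(* forall y_1 ... forall y_m, b   where s = (y_1, ..., y_m) *)
Fixpoint alls F R (s : seq nat) (V : Type) :
    form F R (V + vars s) -> form F R V :=
  match s with
  | [::] => frename (@bind_nil V)
  | y :: s' => fun b => All (alls (frename (@bind_hd V y s') b))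
  end.

Definition theory (F R : language) := set (cform F R ctx0).

Inductive provable F R (T : theory F R) :
  forall c : ctx, seq (cform F R c) -> seq (cform F R c) -> Prop :=
| Pr_axiom a : T a -> @provable F R T ctx0 [::] [:: a]
| Pr_id c a : @provable F R T c [:: a] [:: a]
| Pr_weakL c G D a : @provable F R T c G D -> @provable F R T c (a :: G) D
| Pr_weakR c G D a : @provable F R T c G D -> @provable F R T c G (rcons D a)
| Pr_contrL c G D a :
    @provable F R T c [:: a, a & G] D -> @provable F R T c (a :: G) D
| Pr_contrR c G D a :
    @provable F R T c G (rcons (rcons D a) a) ->
    @provable F R T c G (rcons D a)
| Pr_exchL c G G' D a b :
    @provable F R T c (G ++ [:: a, b & G']) D ->
    @provable F R T c (G ++ [:: b, a & G']) D
| Pr_exchR c G D D' a b :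
    @provable F R T c G (D ++ [:: a, b & D']) ->
    @provable F R T c G (D ++ [:: b, a & D'])
| Pr_cut c G G' D D' a :
    @provable F R T c G (rcons D a) -> @provable F R T c (a :: G') D' ->
    @provable F R T c (G ++ G') (D ++ D')
| Pr_topL c G D : @provable F R T c G D -> @provable F R T c (Top :: G) D
| Pr_topR c G D : @provable F R T c G (rcons D Top)
| Pr_botL c G D : @provable F R T c (Bot :: G) D
| Pr_botR c G D : @provable F R T c G D -> @provable F R T c G (rcons D Bot)
| Pr_andL1 c G D a b :
    @provable F R T c (a :: G) D -> @provable F R T c (And a b :: G) D
| Pr_andL2 c G D a b :
    @provable F R T c (b :: G) D -> @provable F R T c (And a b :: G) D
| Pr_andR c G D a b :
    @provable F R T c G (rcons D a) -> @provable F R T c G (rcons D b) ->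
    @provable F R T c G (rcons D (And a b))
| Pr_orL c G D a b :
    @provable F R T c (a :: G) D -> @provable F R T c (b :: G) D ->
    @provable F R T c (Or a b :: G) D
| Pr_orR1 c G D a b :
    @provable F R T c G (rcons D a) -> @provable F R T c G (rcons D (Or a b))
| Pr_orR2 c G D a b :
    @provable F R T c G (rcons D b) -> @provable F R T c G (rcons D (Or a b))
| Pr_notL c G D a :
    @provable F R T c G (rcons D a) -> @provable F R T c (Not a :: G) D
| Pr_notR c G D a :
    @provable F R T c (a :: G) D -> @provable F R T c G (rcons D (Not a))
| Pr_impL c G D a b :
    @provable F R T c G (rcons D a) -> @provable F R T c (b :: G) D ->
    @provable F R T c (Imp a b :: G) D
| Pr_impR c G D a b :
    @provable F R T c (a :: G) (rcons D b) ->
    @provable F R T c G (rcons D (Imp a b))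
| Pr_enlarge (c : ctx) (x : nat) (xc : x \notin (c : seq nat))
    (G D : seq (cform F R c)) :
    @provable F R T c G D ->
    @provable F R T (ext xc)
      [seq weaken x a | a <- G] [seq weaken x a | a <- D]
| Pr_allL (c : ctx) (x : nat) (xc : x \notin (c : seq nat))
    (G D : seq (cform F R c)) (a : cform F R (ext xc)) (t : cterm F c) :
    @provable F R T c (inst_x t a :: G) D ->
    @provable F R T c (forall_x a :: G) D
| Pr_allR (c : ctx) (x : nat) (xc : x \notin (c : seq nat))
    (G D : seq (cform F R c)) (a : cform F R (ext xc)) :
    @provable F R T (ext xc)
      [seq weaken x b | b <- G] (rcons [seq weaken x b | b <- D] a) ->
    @provable F R T c G (rcons D (forall_x a))
| Pr_exL (c : ctx) (x : nat) (xc : x \notin (c : seq nat))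
    (G D : seq (cform F R c)) (a : cform F R (ext xc)) :
    @provable F R T (ext xc)
      (a :: [seq weaken x b | b <- G]) [seq weaken x b | b <- D] ->
    @provable F R T c (exists_x a :: G) D
| Pr_exR (c : ctx) (x : nat) (xc : x \notin (c : seq nat))
    (G D : seq (cform F R c)) (a : cform F R (ext xc)) (t : cterm F c) :
    @provable F R T c G (rcons D (inst_x t a)) ->
    @provable F R T c G (rcons D (exists_x a)).

Arguments provable {F R} T c G D.

Section Ctx.
Variable F : language.

Lemma vincl_inj (s : seq nat) x : injective (@vincl s x).
Proof. by move=> u v [] /val_inj. Qed.

Definition pshift (s : seq nat) : nat := (\max_(v <- s) v).+1.

(* The names of the second context are shifted past those of the first. *)
Definition prod_names (s s' : seq nat) : seq nat :=
  s ++ [seq pshift s + v | v <- s'].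

Lemma pshift_notin (s : seq nat) v : pshift s + v \notin s.
Proof.
apply/negP => /(@leq_bigmax_seq _ s predT id) /(_ isT) /=.
by rewrite /pshift addSn ltnNge leq_addr.
Qed.

Fact prod_names_uniq (c c' : ctx) : uniq (prod_names c c').
Proof.
rewrite cat_uniq names_uniq map_inj_uniq ?names_uniq ?andbT; last exact: addnI.
by apply/hasPn => _ /mapP [v _ ->]; exact: pshift_notin.
Qed.

Definition ctx_prod (c c' : ctx) : ctx := MkCtx (prod_names_uniq c c').

Fact pinl_in (s s' : seq nat) (v : vars s) : val v \in prod_names s s'.
Proof. by rewrite mem_cat (valP v). Qed.

Fact pinr_in (s s' : seq nat) (v : vars s') :
  pshift s + val v \in prod_names s s'.
Proof. by rewrite mem_cat map_f ?orbT ?(valP v). Qed.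

Definition pinl (s s' : seq nat) (v : vars s) : vars (prod_names s s') :=
  exist _ (val v) (pinl_in s' v).

Definition pinr (s s' : seq nat) (v : vars s') : vars (prod_names s s') :=
  exist _ (pshift s + val v) (pinr_in s v).

Fact psplit_in (s s' : seq nat) (v : vars (prod_names s s')) :
  val v \notin s -> val v - pshift s \in s'.
Proof.
move: (valP v); rewrite mem_cat => /orP [->//|/mapP [u us' ->] _].
by rewrite addKn.
Qed.

Definition psplit (s s' : seq nat) (v : vars (prod_names s s')) :
    vars s + vars s' :=
  match boolP (val v \in s) with
  | AltTrue vs => inl (exist _ (val v) vs)
  | AltFalse vs => inr (exist _ (val v - pshift s) (psplit_in vs))
  end.

Lemma psplit_inl (s s' : seq nat) (v : vars s) :
  psplit (pinl s' v) = inl v.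
Proof.
rewrite /psplit; case: {-}_ / boolP => [vs|/negP[]]; last exact: (valP v).
by congr inl; apply: val_inj.
Qed.

Lemma psplit_inr (s s' : seq nat) (v : vars s') :
  psplit (pinr s v) = inr v.
Proof.
rewrite /psplit; case: {-}_ / boolP => [/= vs|vs].
  by move: (pshift_notin s (val v)); rewrite vs.
by congr inr; apply: val_inj; rewrite /= addKn.
Qed.

Definition punsplit (s s' : seq nat) (v : vars s + vars s') :
    vars (prod_names s s') :=
  match v with inl u => pinl s' u | inr w => pinr s w end.

Lemma punsplitK (s s' : seq nat) : cancel (@punsplit s s') (@psplit s s').
Proof. by case=> v; rewrite /= ?psplit_inl ?psplit_inr. Qed.

Lemma psplitK (s s' : seq nat) : cancel (@psplit s s') (@punsplit s s').
Proof.
move=> v; case: (boolP (val v \in s)) => vs.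
  have -> : v = pinl s' (exist _ (val v) vs) by apply: val_inj.
  by rewrite psplit_inl.
have -> : v = pinr s (exist _ (val v - pshift s) (psplit_in vs)).
  apply: val_inj => /=; move: (valP v); rewrite mem_cat (negPf vs) /=.
  by case/mapP => u _ ->; rewrite addKn.
by rewrite psplit_inr.
Qed.

(* A morphism is a tuple of terms, indexed by the (distinct) variables of the
   target context. *)
Definition ctx_hom (c c' : ctx) : Type := vars c' -> cterm F c.

Definition ctx_comp (c c' c'' : ctx) (g : ctx_hom c' c'') (f : ctx_hom c c') :
    ctx_hom c c'' :=
  fun v => tsubst f (g v).

Fact ctx_comp1m c c' (f : ctx_hom c c') : ctx_comp Var f = f.
Proof. by []. Qed.

Fact ctx_compm1 c c' (f : ctx_hom c c') : ctx_comp f Var = f.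
Proof. by apply/funext => v; exact: tsubst_var. Qed.

Fact ctx_compmA c1 c2 c3 c4 (h : ctx_hom c3 c4) (g : ctx_hom c2 c3)
    (f : ctx_hom c1 c2) :
  ctx_comp h (ctx_comp g f) = ctx_comp (ctx_comp h g) f.
Proof. by apply/funext => v; rewrite /ctx_comp tsubst_tsubst. Qed.

Definition ctx_cat : category :=
  @Category ctx ctx_hom (fun=> Var) ctx_comp ctx_comp1m ctx_compm1 ctx_compmA.

Definition ctx_bang (c : ctx) : ctx_hom c ctx0 :=
  fun v => False_rect _ (vars_nilF v).

Fact ctx_bang_uniq (c : ctx) (f : ctx_hom c ctx0) : f = ctx_bang c.
Proof. by apply/funext => v; case: (vars_nilF v). Qed.

Definition ctx_pr1 (c c' : ctx) : ctx_hom (ctx_prod c c') c :=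
  fun v => Var (pinl c' v).

Definition ctx_pr2 (c c' : ctx) : ctx_hom (ctx_prod c c') c' :=
  fun v => Var (pinr c v).

Arguments ctx_pr1 : clear implicits.
Arguments ctx_pr2 : clear implicits.

Definition ctx_pair (c c' d : ctx) (f : ctx_hom d c) (g : ctx_hom d c') :
    ctx_hom d (ctx_prod c c') :=
  fun v => match psplit v with inl u => f u | inr w => g w end.

Fact ctx_pr1_pair c c' d (f : ctx_hom d c) (g : ctx_hom d c') :
  ctx_comp (ctx_pr1 c c') (ctx_pair f g) = f.
Proof.
by apply/funext => v; rewrite /ctx_comp /= /ctx_pair psplit_inl.
Qed.

Fact ctx_pr2_pair c c' d (f : ctx_hom d c) (g : ctx_hom d c') :
  ctx_comp (ctx_pr2 c c') (ctx_pair f g) = g.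
Proof.
by apply/funext => v; rewrite /ctx_comp /= /ctx_pair psplit_inr.
Qed.

Fact ctx_pair_uniq c c' d (h : ctx_hom d (ctx_prod c c')) :
  h = ctx_pair (ctx_comp (ctx_pr1 c c') h) (ctx_comp (ctx_pr2 c c') h).
Proof.
apply/funext => v; rewrite -(psplitK v) /ctx_pair punsplitK.
by case: (psplit v).
Qed.

Definition Ctx : category_fp :=
  @CategoryFP ctx_cat ctx0 ctx_bang ctx_bang_uniq ctx_prod ctx_pr1 ctx_pr2
    ctx_pair ctx_pr1_pair ctx_pr2_pair ctx_pair_uniq.

End Ctx.

HB.instance Definition _ F R V := gen_eqMixin (form F R V).
HB.instance Definition _ F R V := gen_choiceMixin (form F R V).

Section Derived.
Variables (F R : language) (T : theory F R).
Notation prv := (@provable F R T).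
Implicit Types c : ctx.

Lemma prv_moveL c (A B G : seq (cform F R c)) a D :
  prv c (G ++ a :: A ++ B) D <-> prv c (G ++ A ++ a :: B) D.
Proof.
elim: A G => [//|b A IH] G /=; split => H.
  rewrite -cat_rcons; apply/IH; rewrite cat_rcons.
  exact: Pr_exchL.
by apply: Pr_exchL; rewrite -cat_rcons; apply/IH; rewrite cat_rcons.
Qed.

Lemma prv_moveR c (A B D : seq (cform F R c)) a G :
  prv c G (D ++ a :: A ++ B) <-> prv c G (D ++ A ++ a :: B).
Proof.
elim: A D => [//|b A IH] D /=; split => H.
  rewrite -cat_rcons; apply/IH; rewrite cat_rcons.
  exact: Pr_exchR.
by apply: Pr_exchR; rewrite -cat_rcons; apply/IH; rewrite cat_rcons.
Qed.

Lemma prv_frontL c (A B : seq (cform F R c)) a D :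
  prv c (a :: A ++ B) D <-> prv c (A ++ a :: B) D.
Proof. exact: (@prv_moveL c A B [::]). Qed.

Lemma prv_backR c (A B : seq (cform F R c)) a G :
  prv c G (A ++ a :: B) <-> prv c G (rcons (A ++ B) a).
Proof.
have := @prv_moveR c B [::] A a G.
by rewrite cats0 => ->; rewrite catA cats1.
Qed.

Lemma prv_absorbL c (A : seq (cform F R c)) a D :
  a \in A -> prv c (a :: A) D -> prv c A D.
Proof.
move=> aA; case/splitPr: aA => A1 A2 H; apply/prv_frontL; apply: Pr_contrL.
exact/(@prv_frontL c (a :: A1) A2 a D).
Qed.

Lemma prv_absorbR c (A : seq (cform F R c)) a G :
  a \in A -> prv c G (rcons A a) -> prv c G A.
Proof.
move=> aA; case/splitPr: aA => A1 A2 H; apply/prv_backR; apply: Pr_contrR.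
rewrite rcons_cat; apply/(prv_backR A1 (rcons A2 a)).
by rewrite rcons_cat in H.
Qed.

Lemma prv_sub c (G G' D D' : seq (cform F R c)) :
  {subset G <= G'} -> {subset D <= D'} -> prv c G D -> prv c G' D'.
Proof.
move=> sG sD H.
have {H sG} : prv c G' D.
  have : prv c (G' ++ G) D by elim: (G') => //= a s; apply: Pr_weakL.
  elim: G sG {H} => [|a s IH] sG; first by rewrite cats0.
  move/prv_frontL => H; apply: IH => [b bs|].
    by apply: sG; rewrite inE bs orbT.
  by apply: prv_absorbL H; rewrite mem_cat sG ?mem_head.
move=> H; have {H} : prv c G' (D' ++ D).
  elim: D' {sD} => //= a s IH.
  have [_] := @prv_moveR c (s ++ D) [::] [::] a G'.
  by rewrite /= cats0 cats1; apply; apply: Pr_weakR.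
elim: D sD => [|a s IH] sD; first by rewrite cats0.
move/prv_backR => H; apply: IH => [b bs|].
  by apply: sD; rewrite inE bs orbT.
by apply: prv_absorbR H; rewrite mem_cat sD ?mem_head.
Qed.

Lemma prv_cut1 c (a b d : cform F R c) :
  prv c [:: a] [:: b] -> prv c [:: b] [:: d] -> prv c [:: a] [:: d].
Proof. exact: (@Pr_cut F R T c [:: a] [::] [::] [:: d] b). Qed.

Definition fresh (c : ctx) : nat := pshift c.

Lemma fresh_notin c : fresh c \notin (c : seq nat).
Proof. by rewrite /fresh -[pshift c]addn0 pshift_notin. Qed.

Lemma rcons_self_in (x : nat) (s : seq nat) : x \in rcons s x.
Proof. by rewrite mem_rcons mem_head. Qed.

Definition unbind c x (o : option (vars c)) : vars (rcons c x) :=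
  if o is Some v then vincl x v else exist _ x (rcons_self_in x c).

Lemma unbindK c x : x \notin (c : seq nat) ->
  cancel (@unbind c x) (@vbind c (rcons c x)).
Proof.
by move=> xc [v|] /=; rewrite /vbind /= ?valK // insubN.
Qed.

Lemma vbindK c x : cancel (@vbind c (rcons c x)) (@unbind c x).
Proof.
move=> v; rewrite /vbind; case: insubP => [u _ uv|vc]; apply: val_inj => //=.
by move: (valP v); rewrite mem_rcons inE (negPf vc) orbF => /eqP.
Qed.

Lemma vbind_incl c x (v : vars c) : vbind c (vincl x v) = Some v.
Proof. by rewrite /vbind /= valK. Qed.

Lemma fsubst_ext V W (s r : V -> term F W) (a : form F R V) :
  s =1 r -> fsubst s a = fsubst r a.
Proof. by move=> /funext ->. Qed.

Lemma fsubst_id V (s : V -> term F V) (a : form F R V) :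
  s =1 Var -> fsubst s a = a.
Proof. by move=> /funext ->; rewrite fsubst_var. Qed.

(* Converse of [forall_x] and [exists_x]: the bound variable is named x. *)
Definition body c x (xc : x \notin (c : seq nat))
    (a : form F R (option (vars c))) : cform F R (ext xc) :=
  frename (@unbind c x) a.

Lemma forall_body c x xc a : forall_x (@body c x xc a) = All a.
Proof.
rewrite /forall_x /body /frename fsubst_fsubst fsubst_id // => o /=.
by rewrite unbindK.
Qed.

Lemma exists_body c x xc a : exists_x (@body c x xc a) = Ex a.
Proof.
rewrite /exists_x /body /frename fsubst_fsubst fsubst_id // => o /=.
by rewrite unbindK.
Qed.

Definition finst V (t : term F V) (a : form F R (option V)) : form F R V :=
  fsubst (fun o => if o is Some v then Var v else t) a.

Lemma inst_body c x xc t a : inst_x t (@body c x xc a) = finst t a.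
Proof.
rewrite /inst_x /body /frename fsubst_fsubst; apply: fsubst_ext => o /=.
by rewrite unbindK //; case: o.
Qed.

Lemma prv_allL c (a : form F R (option (vars c))) t G D :
  prv c (finst t a :: G) D -> prv c (All a :: G) D.
Proof.
move=> H; rewrite -(forall_body (fresh_notin c)); apply: (Pr_allL (t := t)).
by rewrite inst_body.
Qed.

Lemma prv_exR c (a : form F R (option (vars c))) t G D :
  prv c G (rcons D (finst t a)) -> prv c G (rcons D (Ex a)).
Proof.
move=> H; rewrite -(exists_body (fresh_notin c)); apply: (Pr_exR (t := t)).
by rewrite inst_body.
Qed.

Lemma prv_allR c x (xc : x \notin (c : seq nat)) a G D :
  prv (ext xc) (map (@weaken F R c x) G)
    (rcons (map (@weaken F R c x) D) (body xc a)) ->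
  prv c G (rcons D (All a)).
Proof. by move=> H; rewrite -(forall_body xc); apply: Pr_allR. Qed.

Lemma prv_exL c x (xc : x \notin (c : seq nat)) a G D :
  prv (ext xc) (body xc a :: map (@weaken F R c x) G)
    (map (@weaken F R c x) D) ->
  prv c (Ex a :: G) D.
Proof. by move=> H; rewrite -(exists_body xc); apply: Pr_exL. Qed.

Definition sext c c' x x' (s : vars c -> cterm F c') :
    vars (rcons c x) -> cterm F (rcons c' x') :=
  fun v => tsubst (fun w => Var (@unbind c' x' w)) (slift s (vbind c v)).

Lemma sext_weaken c c' x x' (s : vars c -> cterm F c') (a : cform F R c) :
  fsubst (@sext c c' x x' s) (weaken x a) = weaken x' (fsubst s a).
Proof.
rewrite /weaken /frename !fsubst_fsubst; apply: fsubst_ext => v /=.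
by rewrite /sext vbind_incl /= tsubst_tsubst.
Qed.

Lemma sext_body c c' x x' (xc : x \notin (c : seq nat))
    (xc' : x' \notin (c' : seq nat)) (s : vars c -> cterm F c')
    (a : form F R (option (vars c))) :
  fsubst (@sext c c' x x' s) (body xc a) = body xc' (fsubst (slift s) a).
Proof.
rewrite /body /frename !fsubst_fsubst; apply: fsubst_ext => v /=.
by rewrite /sext unbindK.
Qed.

Lemma body_vbind c x (xc : x \notin (c : seq nat)) a :
  body xc (frename (@vbind c _) a) = a.
Proof.
by rewrite /body /frename fsubst_fsubst fsubst_id // => v /=; rewrite vbindK.
Qed.

Lemma prv_axiom c a (s : vars ctx0 -> cterm F c) :
  T a -> prv c [::] [:: fsubst s a].
Proof.
move=> Ta; case: c s => n cu s.
suff H (m : seq nat) (mu : uniq m) (r : vars [::] -> cterm F m) :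
  prv (MkCtx mu) [::] [:: fsubst r a] by exact: H.
elim/last_ind: m mu r {n cu s} => [|n x IH] cu s.
  rewrite (bool_irrelevance cu isT) fsubst_id; first exact: Pr_axiom.
  by move=> v; case: (vars_nilF v).
have xn : x \notin n by move: cu; rewrite rcons_uniq => /andP[].
have nu : uniq n by move: cu; rewrite rcons_uniq => /andP[].
have := @Pr_enlarge F R T (MkCtx nu) x xn _ _ (IH nu (ctx_bang F (MkCtx nu))).
rewrite /ext (bool_irrelevance (@ext_uniq (MkCtx nu) x xn) cu) /= /weaken /frename.
rewrite fsubst_fsubst (fsubst_ext (r := s)) // => v.
by case: (vars_nilF v).
Qed.

Lemma prv_subst c c' (s : vars c -> cterm F c') G D :
  prv c G D -> prv c' (map (fsubst s) G) (map (fsubst s) D).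
Proof.
move=> H; elim: c G D / H c' s => /=.
- by move=> a Ta c' s; apply: prv_axiom.
- by move=> *; apply: Pr_id.
- by move=> c G D a _ IH c' s; apply: Pr_weakL.
- by move=> c G D a _ IH c' s; rewrite map_rcons; apply: Pr_weakR.
- by move=> c G D a _ IH c' s; apply: Pr_contrL; apply: IH.
- move=> c G D a _ IH c' s; rewrite map_rcons; apply: Pr_contrR.
  by have := IH c' s; rewrite !map_rcons.
- move=> c G G' D a b _ IH c' s; rewrite map_cat /=; apply: Pr_exchL.
  by have := IH c' s; rewrite map_cat.
- move=> c G D D' a b _ IH c' s; rewrite map_cat /=; apply: Pr_exchR.
  by have := IH c' s; rewrite map_cat.
- move=> c G G' D D' a _ IH _ IH' c' s; rewrite !map_cat.
  by apply: (Pr_cut (a := fsubst s a)); rewrite -?map_rcons.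
- by move=> c G D _ IH c' s; apply: Pr_topL.
- by move=> c G D c' s; rewrite map_rcons; apply: Pr_topR.
- by move=> c G D c' s; apply: Pr_botL.
- by move=> c G D _ IH c' s; rewrite map_rcons; apply: Pr_botR.
- by move=> c G D a b _ IH c' s; apply: Pr_andL1; apply: IH.
- by move=> c G D a b _ IH c' s; apply: Pr_andL2; apply: IH.
- move=> c G D a b _ IH _ IH' c' s; rewrite map_rcons.
  by apply: Pr_andR; rewrite -map_rcons.
- by move=> c G D a b _ IH _ IH' c' s; apply: Pr_orL; [apply: IH|apply: IH'].
- move=> c G D a b _ IH c' s; rewrite map_rcons; apply: Pr_orR1.
  by rewrite -map_rcons.
- move=> c G D a b _ IH c' s; rewrite map_rcons; apply: Pr_orR2.
  by rewrite -map_rcons.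
- by move=> c G D a _ IH c' s; apply: Pr_notL; rewrite -map_rcons.
- by move=> c G D a _ IH c' s; rewrite map_rcons; apply: Pr_notR; apply: IH.
- move=> c G D a b _ IH _ IH' c' s; apply: Pr_impL; last exact: IH'.
  by rewrite -map_rcons.
- move=> c G D a b _ IH c' s; rewrite map_rcons; apply: Pr_impR.
  by rewrite -map_rcons; apply: IH.
- move=> c x xc G D _ IH c' s.
  have := IH c' (fun v => s (vincl x v)).
  by rewrite -!map_comp; congr provable; apply: eq_map => a /=;
    rewrite /weaken /frename fsubst_fsubst.
- move=> c x xc G D a t _ IH c' s.
  apply: (prv_allL (t := tsubst s t)).
  have := IH c' s; congr (provable _ _ (_ :: _) _).
  rewrite /finst /inst_x /frename !fsubst_fsubst; apply: fsubst_ext => v /=.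
  case: (vbind c v) => //= w; rewrite tsubst_tsubst.
  exact/esym/tsubst_var.
- move=> c x xc G D a _ IH c' s; rewrite map_rcons.
  apply: (prv_allR (xc := fresh_notin c')).
  have := IH (ext (fresh_notin c')) (@sext c c' x (fresh c') s); rewrite map_rcons -!map_comp.
  rewrite -{1}(body_vbind (xc := xc) a) (sext_body xc (fresh_notin c')).
  by congr (provable _ _ _ (rcons _ _)); apply: eq_map => b /=;
    rewrite sext_weaken.
- move=> c x xc G D a _ IH c' s.
  apply: (prv_exL (xc := fresh_notin c')).
  have := IH (ext (fresh_notin c')) (@sext c c' x (fresh c') s); rewrite -!map_comp.
  rewrite -{1}(body_vbind (xc := xc) a) (sext_body xc (fresh_notin c')).
  by congr (provable _ _ (_ :: _) _); apply: eq_map => b /=;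
    rewrite sext_weaken.
- move=> c x xc G D a t _ IH c' s; rewrite map_rcons.
  apply: (prv_exR (t := tsubst s t)).
  have := IH c' s; rewrite map_rcons; congr (provable _ _ _ (rcons _ _)).
  rewrite /finst /inst_x /frename !fsubst_fsubst; apply: fsubst_ext => v /=.
  case: (vbind c v) => //= w; rewrite tsubst_tsubst.
  exact/esym/tsubst_var.
Qed.

Lemma prv_all_adj c x (xc : x \notin (c : seq nat)) a b :
  prv (ext xc) [:: weaken x a] [:: body xc b] <-> prv c [:: a] [:: All b].
Proof.
split=> H; first exact: (@prv_allR c x xc b [:: a] [::]).
have {}H : prv (ext xc) [:: weaken x a] [:: weaken x (All b)].
  by have := Pr_enlarge xc H.
apply: prv_cut1 H _; rewrite /weaken /frename /=.
apply: (@prv_allL (ext xc) _ (Var (exist _ x (rcons_self_in x c))) [::]).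
rewrite /finst fsubst_fsubst; set b' := fsubst _ _.
suff -> : b' = body xc b by exact: Pr_id.
by apply: fsubst_ext; case.
Qed.

Definition sum_lift V W Z (s : V -> term F W) (v : V + Z) : term F (W + Z) :=
  match v with
  | inl u => tsubst (fun w => Var (inl w)) (s u)
  | inr z => Var (inr z)
  end.

Lemma alls_subst s V W (f : V -> term F W) (b : form F R (V + vars s)) :
  fsubst f (alls b) = alls (fsubst (@sum_lift V W (vars s) f) b).
Proof.
elim: s V W f b => [|y s IH] V W f b /=.
  rewrite /frename !fsubst_fsubst; apply: fsubst_ext => -[v|v] /=.
    by rewrite tsubst_tsubst tsubst_var.
  by case: (vars_nilF v).
rewrite IH; congr (All (alls _)); rewrite /frename !fsubst_fsubst.
apply: fsubst_ext => -[v|v] /=; first by rewrite !tsubst_tsubst.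
by case: (vbind s v).
Qed.

Definition unbind_hd V y s (v : option V + vars s) : V + vars (y :: s) :=
  match v with
  | inl (Some u) => inl u
  | inl None => inr (exist _ y (mem_head y s))
  | inr w => inr (exist _ (val w) (mem_behead (s := y :: s) (valP w)))
  end.

Lemma bind_hdK V y s : cancel (@bind_hd V y s) (@unbind_hd V y s).
Proof.
case=> [//|v] /=; rewrite /vbind; case: insubP => [u _ uv|vs] /=;
  congr inr; apply: val_inj => //=.
by move: (valP v); rewrite inE (negPf vs) orbF => /eqP.
Qed.

Lemma unbind_hdK V y s : y \notin s -> cancel (@unbind_hd V y s) (@bind_hd V y s).
Proof.
by move=> ys [[v|]|v] //=; rewrite /vbind /= ?valK // insubN.
Qed.

Lemma prv_rename c c' (r : vars c -> vars c') a b :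
  prv c [:: a] [:: b] -> prv c' [:: frename r a] [:: frename r b].
Proof. exact: (@prv_subst c c' (fun v => Var (r v)) [:: a] [:: b]). Qed.

Lemma frename_frename V W Z (r : W -> Z) (q : V -> W) (a : form F R V) :
  frename r (frename q a) = frename (fun v => r (q v)) a.
Proof. exact: fsubst_fsubst. Qed.

Lemma frename_id V (r : V -> V) (a : form F R V) : r =1 id -> frename r a = a.
Proof. by move=> /funext ->; exact: fsubst_var. Qed.

Lemma frename_ext V W (r q : V -> W) (a : form F R V) :
  r =1 q -> frename r a = frename q a.
Proof. by move=> /funext ->. Qed.

Lemma prv_alls_adj (s : seq nat) (c c' : ctx)
    (e : vars c + vars s -> vars c') (e' : vars c' -> vars c + vars s)
    (a : cform F R c) (b : form F R (vars c + vars s)) :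
  uniq s -> cancel e e' -> cancel e' e ->
  prv c' [:: frename (fun v => e (inl v)) a] [:: frename e b] <->
  prv c [:: a] [:: alls b].
Proof.
elim: s c c' e e' a b => [|y s IH] c c' e e' a b /= us eK e'K.
  split=> [/(prv_rename (fun v => bind_nil (e' v)))|/(prv_rename (fun v => e (inl v)))].
    rewrite !frename_frename frename_id => [|v]; last by rewrite eK.
    by rewrite (frename_ext (q := @bind_nil (vars c))) // => v; rewrite eK.
  rewrite !frename_frename (frename_ext (q := e) b) // => -[v //|v].
  by case: (vars_nilF v).
have [ys {}us] := andP us.
rewrite -(prv_all_adj (fresh_notin c)).
pose x := fresh c; pose c2 := ext (fresh_notin c).
pose m (v : vars c2 + vars s) : option (vars c) + vars s :=
  match v with inl u => inl (vbind c u) | inr w => inr w end.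
pose m' (v : option (vars c) + vars s) : vars c2 + vars s :=
  match v with inl u => inl (unbind x u) | inr w => inr w end.
have mK : cancel m m' by case=> //= v; rewrite vbindK.
have m'K : cancel m' m by case=> //= v; rewrite unbindK // fresh_notin.
have -> : body (fresh_notin c) (alls (frename (@bind_hd _ y s) b)) =
    alls (frename (fun v => m' (bind_hd v)) b).
  rewrite /body /frename alls_subst fsubst_fsubst; congr alls.
  by apply: fsubst_ext => v /=; case: (bind_hd v).
rewrite -(IH c2 c' (fun v => e (unbind_hd y (m v)))
                   (fun v => m' (bind_hd (e' v)))) //; first last.
- by move=> v; rewrite m'K bind_hdK e'K.
- by move=> v; rewrite eK unbind_hdK // mK.
rewrite /weaken !frename_frename.
rewrite (frename_ext (q := e) b) => [|v]; last by rewrite m'K bind_hdK.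
rewrite (frename_ext (q := fun v => e (inl v)) a) // => v.
by rewrite /m vbind_incl.
Qed.

Lemma prv_ax c G D (a : cform F R c) : a \in G -> a \in D -> prv c G D.
Proof.
move=> aG aD; apply: (@prv_sub c [:: a] _ [:: a]) (Pr_id _ _) => b;
  by rewrite inE => /eqP ->.
Qed.

Lemma prv_andL c G D (a b : cform F R c) :
  prv c [:: a, b & G] D -> prv c (And a b :: G) D.
Proof.
move=> H; apply: Pr_contrL; apply: Pr_andL1.
by apply: (@Pr_exchL F R T c [::]); apply: Pr_andL2; apply: (@Pr_exchL F R T c [::]).
Qed.

Lemma prv_and c (a b d : cform F R c) :
  prv c [:: d] [:: And a b] <-> prv c [:: d] [:: a] /\ prv c [:: d] [:: b].
Proof.
split=> [H|[]]; last exact: (@Pr_andR F R T c [:: d] [::]).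
split; apply: prv_cut1 H _; first by apply: Pr_andL1; apply: Pr_id.
by apply: Pr_andL2; apply: Pr_id.
Qed.

Lemma prv_or c (a b d : cform F R c) :
  prv c [:: Or a b] [:: d] <-> prv c [:: a] [:: d] /\ prv c [:: b] [:: d].
Proof.
split=> [H|[]]; last exact: Pr_orL.
by split; apply: prv_cut1 _ H; [apply: (@Pr_orR1 F R T c _ [::])
  |apply: (@Pr_orR2 F R T c _ [::])]; apply: Pr_id.
Qed.

Lemma prv_distr c (a b d : cform F R c) :
  prv c [:: And (Or a b) d] [:: Or (And a d) (And b d)].
Proof.
apply: prv_andL; apply: Pr_orL.
  apply: (@Pr_orR1 F R T c _ [::]); apply: (@Pr_andR F R T c _ [::]).
    by apply: (prv_ax (a := a)); rewrite !inE ?eqxx.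
  by apply: (prv_ax (a := d)); rewrite !inE ?eqxx ?orbT.
apply: (@Pr_orR2 F R T c _ [::]); apply: (@Pr_andR F R T c _ [::]).
  by apply: (prv_ax (a := b)); rewrite !inE ?eqxx.
by apply: (prv_ax (a := d)); rewrite !inE ?eqxx ?orbT.
Qed.

Lemma prv_em c (a d : cform F R c) : prv c [:: d] [:: Or a (Not a)].
Proof.
apply: (@Pr_contrR F R T c _ [::]).
apply: (@Pr_orR2 F R T c _ [:: Or a (Not a)]).
apply: (@Pr_notR F R T c _ [:: Or a (Not a)]).
by apply: (@Pr_orR1 F R T c _ [::]); apply: (prv_ax (a := a)); rewrite !inE ?eqxx ?orbT.
Qed.

Lemma prv_absurd c (a d : cform F R c) : prv c [:: And a (Not a)] [:: d].
Proof.
apply: prv_andL; apply: (@Pr_exchL F R T c [::]); apply: Pr_notL.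
by apply: (prv_ax (a := a)); rewrite !inE ?eqxx ?orbT.
Qed.

End Derived.

Section Lindenbaum.
Variables (F R : language) (T : theory F R).
Notation prv := (@provable F R T).
Implicit Types c : ctx.

Definition prv_equiv (c : ctx) : rel (cform F R c) :=
  fun a b => `[< prv c [:: a] [:: b] /\ prv c [:: b] [:: a] >].

Fact prv_equiv_refl c : reflexive (@prv_equiv c).
Proof. by move=> a; apply/asboolP; split; exact: Pr_id. Qed.

Fact prv_equiv_sym c : symmetric (@prv_equiv c).
Proof. by move=> a b; apply/asboolP/asboolP => -[]. Qed.

Fact prv_equiv_trans c : transitive (@prv_equiv c).
Proof.
move=> b a d /asboolP[ab ba] /asboolP[bd db]; apply/asboolP; split.
  exact: prv_cut1 ab bd.
exact: prv_cut1 db ba.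
Qed.

Canonical prv_equiv_equiv c : equiv_rel (cform F R c) :=
  EquivRel (@prv_equiv c) (@prv_equiv_refl c) (@prv_equiv_sym c)
    (@prv_equiv_trans c).

Definition LTsort (c : ctx) : Type := {eq_quot (prv_equiv_equiv c)}.

HB.instance Definition _ (c : ctx) := Choice.on (LTsort c).

Definition cls (c : ctx) (a : cform F R c) : LTsort c :=
  \pi_({eq_quot (prv_equiv_equiv c)}) a.

Lemma cls_surj c (q : LTsort c) : exists a, q = cls a.
Proof. by exists (repr q); rewrite /cls reprK. Qed.

Lemma cls_eqP c (a b : cform F R c) :
  cls a = cls b <-> prv c [:: a] [:: b] /\ prv c [:: b] [:: a].
Proof.
split=> [/eqmodP /asboolP //|H].
by apply/eqmodP/asboolP.
Qed.

Definition rep (c : ctx) (q : LTsort c) : cform F R c :=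
  repr (q : {eq_quot (prv_equiv_equiv c)}).

Lemma repK c (q : LTsort c) : cls (rep q) = q.
Proof. exact: reprK. Qed.

Lemma rep_cls c (a : cform F R c) :
  prv c [:: rep (cls a)] [:: a] /\ prv c [:: a] [:: rep (cls a)].
Proof. by apply/cls_eqP; rewrite repK. Qed.

Definition LTle (c : ctx) : rel (LTsort c) :=
  fun q r => `[< prv c [:: rep q] [:: rep r] >].

Lemma LTle_cls c (a b : cform F R c) :
  LTle (cls a) (cls b) <-> prv c [:: a] [:: b].
Proof.
have [aa' a'a] := rep_cls a; have [bb' b'b] := rep_cls b.
split=> [/asboolP H|H]; last apply/asboolP.
  exact: prv_cut1 (prv_cut1 a'a H) bb'.
exact: prv_cut1 (prv_cut1 aa' H) b'b.
Qed.

Fact LT_display : Order.disp_t. Proof. exact: Order.Disp tt tt. Qed.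

Fact LTle_refl c : reflexive (@LTle c).
Proof. by move=> q; apply/asboolP; exact: Pr_id. Qed.

Fact LTle_anti c : antisymmetric (@LTle c).
Proof.
move=> q r /andP[/asboolP qr /asboolP rq].
by rewrite -(repK q) -(repK r); apply/cls_eqP.
Qed.

Fact LTle_trans c : transitive (@LTle c).
Proof.
move=> r q s /asboolP qr /asboolP rs; apply/asboolP; exact: prv_cut1 qr rs.
Qed.

HB.instance Definition _ (c : ctx) :=
  Order.Le_isPOrder.Build LT_display (LTsort c)
    (@LTle_refl c) (@LTle_anti c) (@LTle_trans c).

Lemma le_cls c (a b : cform F R c) :
  (cls a <= cls b :> LTsort c)%O <-> prv c [:: a] [:: b].
Proof. exact: LTle_cls. Qed.

Definition LTmeet c (q r : LTsort c) : LTsort c := cls (And (rep q) (rep r)).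
Definition LTjoin c (q r : LTsort c) : LTsort c := cls (Or (rep q) (rep r)).
Definition LTcompl c (q : LTsort c) : LTsort c := cls (Not (rep q)).

Fact LT_lexI c (x y z : LTsort c) :
  (x <= LTmeet y z)%O = (x <= y)%O && (x <= z)%O.
Proof.
rewrite -{1 2 3}(repK x) -{2}(repK y) -{2}(repK z) /LTmeet.
apply/idP/andP => [/le_cls/prv_and[]|[/le_cls H /le_cls H']].
  by move=> ? ?; split; apply/le_cls.
by apply/le_cls/prv_and.
Qed.

Fact LT_leUx c (x y z : LTsort c) :
  (LTjoin x y <= z)%O = (x <= z)%O && (y <= z)%O.
Proof.
rewrite -{1 2 3}(repK z) -{2}(repK x) -{2}(repK y) /LTjoin.
apply/idP/andP => [/le_cls/prv_or[]|[/le_cls H /le_cls H']].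
  by move=> ? ?; split; apply/le_cls.
by apply/le_cls/prv_or.
Qed.

Fact LT_le0x c (x : LTsort c) : (cls Bot <= x)%O.
Proof. by rewrite -(repK x); apply/le_cls; exact: Pr_botL. Qed.

Fact LT_lex1 c (x : LTsort c) : (x <= cls Top)%O.
Proof.
by rewrite -(repK x); apply/le_cls; exact: (@Pr_topR F R T c _ [::]).
Qed.

HB.instance Definition _ (c : ctx) :=
  Order.POrder_isMeetSemilattice.Build LT_display (LTsort c) (@LT_lexI c).
HB.instance Definition _ (c : ctx) :=
  Order.POrder_isJoinSemilattice.Build LT_display (LTsort c) (@LT_leUx c).
HB.instance Definition _ (c : ctx) :=
  Order.hasBottom.Build LT_display (LTsort c) (@LT_le0x c).
HB.instance Definition _ (c : ctx) :=
  Order.hasTop.Build LT_display (LTsort c) (@LT_lex1 c).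

Lemma cls_and c (a b : cform F R c) : cls (And a b) = (cls a `&` cls b)%O.
Proof.
apply/le_anti; rewrite lexI; apply/andP; split.
  apply/andP; split; apply/le_cls; first exact/Pr_andL1/Pr_id.
  exact/Pr_andL2/Pr_id.
apply/le_cls/prv_and; split; apply/le_cls.
  exact: (@leIl _ (LTsort c) (cls a) (cls b)).
exact: (@leIr _ (LTsort c) (cls b) (cls a)).
Qed.

Lemma cls_or c (a b : cform F R c) : cls (Or a b) = (cls a `|` cls b)%O.
Proof.
apply/le_anti; rewrite leUx; apply/andP; split; last first.
  apply/andP; split; apply/le_cls.
    exact/(@Pr_orR1 F R T c _ [::])/Pr_id.
  exact/(@Pr_orR2 F R T c _ [::])/Pr_id.
apply/le_cls/prv_or; split; apply/le_cls.
  exact: (@leUl _ (LTsort c) (cls a) (cls b)).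
exact: (@leUr _ (LTsort c) (cls b) (cls a)).
Qed.

Fact LT_meetUl c :
  @left_distributive (LTsort c) (LTsort c) Order.meet Order.join.
Proof.
move=> x y z; rewrite -(repK x) -(repK y) -(repK z).
apply/le_anti/andP; split.
  by rewrite -cls_or -!cls_and -cls_or; apply/le_cls; exact: prv_distr.
by rewrite leUx !lexI !leIr !andbT; apply/andP; split;
  rewrite (le_trans (leIl _ _)) ?leUl ?leUr.
Qed.

HB.instance Definition _ (c : ctx) :=
  Order.Lattice_Meet_isDistrLattice.Build LT_display (LTsort c) (@LT_meetUl c).

Fact LT_joinxC c (x : LTsort c) : (x `|` LTcompl x)%O = \top%O.
Proof.
apply/le_anti; rewrite lex1 /LTcompl -{1}(repK x) -cls_or; apply/le_cls.
exact: prv_em.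
Qed.

Fact LT_meetxC c (x : LTsort c) : (x `&` LTcompl x)%O = \bot%O.
Proof.
apply/le_anti; rewrite le0x andbT /LTcompl -{1}(repK x) -cls_and; apply/le_cls.
exact: prv_absurd.
Qed.

HB.instance Definition _ (c : ctx) :=
  Order.TBDistrLattice_hasComplement.Build LT_display (LTsort c)
    (@LT_joinxC c) (@LT_meetxC c).

Definition LTob (c : Ctx F) : ctbDistrLatticeType LT_display := LTsort c.

Lemma cls_not c (a : cform F R c) : cls (Not a) = (~` cls a)%O.
Proof.
apply/cls_eqP; have [aa' a'a] := rep_cls a; split.
  apply: (@Pr_notR F R T c _ [::]); apply: (@Pr_exchL F R T c [::]).
  exact: Pr_notL.
apply: (@Pr_notR F R T c _ [::]); apply: (@Pr_exchL F R T c [::]).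
exact: Pr_notL.
Qed.

Lemma cls_top (c : ctx) : cls Top = \top%O :> LTsort c. Proof. by []. Qed.

Lemma cls_bot (c : ctx) : cls Bot = \bot%O :> LTsort c. Proof. by []. Qed.

Definition LTmap (c c' : Ctx F) (f : hom c c') (q : LTob c') : LTob c :=
  cls (fsubst f (rep q)).

Lemma LTmap_cls c c' (f : @hom (Ctx F) c c') (a : cform F R c') :
  LTmap f (cls a) = cls (fsubst f a).
Proof.
have [aa' a'a] := rep_cls a; apply/cls_eqP; split.
  exact: (@prv_subst F R T c' c f [:: _] [:: _]).
exact: (@prv_subst F R T c' c f [:: _] [:: _]).
Qed.

Section LTmap.
Variables (c c' : Ctx F) (f : hom c c').

Fact LTmapI : Order.meet_morphism (LTmap f).
Proof.
move=> x y; rewrite -(repK x) -(repK y).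
by rewrite -cls_and !LTmap_cls -cls_and.
Qed.

Fact LTmapU : Order.join_morphism (LTmap f).
Proof.
move=> x y; rewrite -(repK x) -(repK y).
by rewrite -cls_or !LTmap_cls -cls_or.
Qed.

Fact LTmap0 : LTmap f \bot%O = \bot%O.
Proof. by rewrite -!cls_bot LTmap_cls. Qed.

Fact LTmap1 : LTmap f \top%O = \top%O.
Proof. by rewrite -!cls_top LTmap_cls. Qed.

Fact LTmapC : {morph LTmap f : x / (~` x)%O}.
Proof. by move=> x; rewrite -(repK x) -cls_not !LTmap_cls -cls_not. Qed.

Definition LTdmap : boolHom (LTob c') (LTob c) :=
  BoolHom LTmapI LTmapU LTmap0 LTmap1 LTmapC.
End LTmap.

Fact LTdmap1 (c : Ctx F) (a : LTob c) : LTdmap (idm c) a = a.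
Proof. by rewrite -(repK a) /= LTmap_cls fsubst_var. Qed.

Fact LTdmapM (c1 c2 c3 : Ctx F) (g : hom c2 c3) (f : hom c1 c2) (a : LTob c3) :
  LTdmap (g \oc f) a = LTdmap f (LTdmap g a).
Proof. by rewrite -(repK a) /= !LTmap_cls fsubst_fsubst. Qed.

Definition LTdoc : boolean_doctrine LT_display (Ctx F) :=
  @BooleanDoctrine LT_display (Ctx F) LTob LTdmap LTdmap1 LTdmapM.

Definition LTfall (c c' : Ctx F) (q : LTob (c \x c')) : LTob c :=
  cls (alls (frename (@psplit c c') (rep q))).

Lemma frename_psplit (c c' : ctx) (b : cform F R (ctx_prod c c')) :
  frename (@punsplit c c') (frename (@psplit c c') b) = b.
Proof. by rewrite frename_frename frename_id // => v; rewrite psplitK. Qed.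

Lemma prv_prod_adj (c c' : ctx) (a : cform F R c)
    (b : cform F R (ctx_prod c c')) :
  prv (ctx_prod c c') [:: fsubst (@ctx_pr1 F c c') a] [:: b] <->
  prv c [:: a] [:: alls (frename (@psplit c c') b)].
Proof.
rewrite -(@prv_alls_adj F R T c' c (ctx_prod c c') (@punsplit c c')
  (@psplit c c')) ?names_uniq ?frename_psplit //.
- exact: punsplitK.
- exact: psplitK.
Qed.

Lemma LTfall_cls (c c' : ctx) (b : cform F R (ctx_prod c c')) :
  LTfall (cls b) = cls (alls (frename (@psplit c c') b)).
Proof.
have [bb' b'b] := rep_cls b; apply/cls_eqP; split; apply/prv_prod_adj.
  by apply: prv_cut1 bb'; apply/prv_prod_adj; exact: Pr_id.
by apply: prv_cut1 b'b; apply/prv_prod_adj; exact: Pr_id.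
Qed.

Fact LTfall_adj (c c' : Ctx F) (a : LTdoc c) (b : LTdoc (c \x c')) :
  (dmap LTdoc (pr1 c c') a <= b)%O = (a <= LTfall b)%O.
Proof.
rewrite -(repK a) -(repK b) LTfall_cls /= LTmap_cls.
by apply/idP/idP => /le_cls H; apply/le_cls/prv_prod_adj.
Qed.

Fact LTfall_BC (c1 c1' c2 : Ctx F) (f : hom c1' c1) (b : LTdoc (c1 \x c2)) :
  dmap LTdoc f (LTfall b) = LTfall (dmap LTdoc (prod_id c2 f) b).
Proof.
rewrite -(repK b) LTfall_cls /= !LTmap_cls LTfall_cls; congr cls.
rewrite alls_subst; congr alls; rewrite /frename !fsubst_fsubst.
apply: fsubst_ext => v; rewrite -(psplitK v) punsplitK /=.
rewrite /ctx_pair punsplitK.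
case: (psplit v) => u /=; last by rewrite psplit_inr.
rewrite /ctx_comp tsubst_tsubst; congr tsubst; apply/funext => w /=.
by rewrite psplit_inl.
Qed.

Definition LT : fo_doctrine LT_display (Ctx F) :=
  @FoDoctrine LT_display (Ctx F) LTdoc LTfall LTfall_adj LTfall_BC.

Definition LT0 (c : Ctx F) : set (LT c) :=
  [set cls a | a in [set a : cform F R c | qfree a]].

End Lindenbaum.

Arguments LT0 {F R} T c.

(* Main.v *)
(* Take one predicate symbol, of arity the length of X, for each context X and
   each element of P0(X); interpret formulas in P, and let the theory consist of
   the closed formulas of value top.  Provable sequents are valid in P, and
   conversely a formula of value top has a universal closure in the theory, so
   interpretation embeds LT(T) in P as an order.  Its image contains P0 and is
   closed under Boolean operations and all quantifiers (forall Y), so it contains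
   every stratum and is all of P. *)

Require Import Defs.
From HB Require Import structures.
From mathcomp Require Import all_boot all_order.
From mathcomp Require Import boolp classical_sets.

Set Implicit Arguments.
Unset Strict Implicit.
Unset Printing Implicit Defensive.

Import Order.Theory.

Local Open Scope classical_set_scope.

(** * Boolean inequalities and inverses of Boolean homomorphisms *)

Section BooleanAlgebra.
Variables (d : Order.disp_t) (A : ctbDistrLatticeType d).
Implicit Types x y z : A.

Lemma leI_compl x y z : (x `&` ~` y <= z)%O = (x <= y `|` z)%O.
Proof. by rewrite -diffE leBLR. Qed.

(** Serves as the cut rule in the soundness proof, [z] being the value of the cut formula. *)
Lemma le_cut x y z : (x <= y `|` z)%O -> (x `&` z <= y)%O -> (x <= y)%O.
Proof.
move=> xyz xzy; have -> : x = (x `&` (y `|` z))%O by apply/esym/meet_idPl.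
by rewrite meetUr leUx leIr.
Qed.

End BooleanAlgebra.

Lemma eq_lower d (A : porderType d) (x y : A) :
  (forall z : A, (z <= x)%O = (z <= y)%O) -> x = y.
Proof. by move=> H; apply/le_anti; rewrite -H lexx H lexx. Qed.

Section BoolHom.
Variables (d d' : Order.disp_t) (A : ctbDistrLatticeType d).
Variables (B : ctbDistrLatticeType d') (f : boolHom A B).

Lemma boolHom_le x y : (x <= y)%O -> (f x <= f y)%O.
Proof. by rewrite !leEmeet -bhomI => /eqP ->. Qed.

Variables (g : B -> A) (fK : cancel f g) (gK : cancel g f).

Fact boolHom_invI : Order.meet_morphism g.
Proof. by move=> x y; rewrite -{1}(gK x) -{1}(gK y) -bhomI fK. Qed.
Fact boolHom_invU : Order.join_morphism g.
Proof. by move=> x y; rewrite -{1}(gK x) -{1}(gK y) -bhomU fK. Qed.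
Fact boolHom_inv0 : g \bot%O = \bot%O. Proof. by rewrite -(bhom0 f) fK. Qed.
Fact boolHom_inv1 : g \top%O = \top%O. Proof. by rewrite -(bhom1 f) fK. Qed.
Fact boolHom_invC : {morph g : x / (~` x)%O}.
Proof. by move=> x; rewrite -{1}(gK x) -bhomC fK. Qed.

Definition boolHom_inv : boolHom B A :=
  BoolHom boolHom_invI boolHom_invU boolHom_inv0 boolHom_inv1 boolHom_invC.

(** An order isomorphism is adjoint to its inverse; this form combines with [fall_adj]. *)
Lemma boolHom_can_le x y : (g x <= y)%O = (x <= f y)%O.
Proof.
apply/idP/idP => [/boolHom_le|]; first by rewrite gK.
by rewrite !leEmeet -{2}(fK y) -boolHom_invI => /eqP ->.
Qed.

End BoolHom.

Lemma forall_in_cons (T : eqType) (Q : T -> Prop) a (G : seq T) :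
  (forall b, b \in a :: G -> Q b) <-> Q a /\ forall b, b \in G -> Q b.
Proof.
split=> [H|[Qa H] b]; last by rewrite inE => /orP[/eqP ->|/H].
by split=> [|b bG]; apply: H; rewrite inE ?eqxx ?bG ?orbT.
Qed.

Lemma forall_in_rcons (T : eqType) (Q : T -> Prop) a (G : seq T) :
  (forall b, b \in rcons G a -> Q b) <-> Q a /\ forall b, b \in G -> Q b.
Proof.
by rewrite -forall_in_cons; split=> H b bG; apply: H; move: bG; rewrite mem_rcons.
Qed.

Lemma forall_in_cat (T : eqType) (Q : T -> Prop) (G G' : seq T) :
  (forall b, b \in G ++ G' -> Q b) <->
  (forall b, b \in G -> Q b) /\ forall b, b \in G' -> Q b.
Proof.
split=> [H|[H H'] b]; last by rewrite mem_cat => /orP[/H|/H'].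
by split=> b bG; apply: H; rewrite mem_cat bG ?orbT.
Qed.

(** * Natural isomorphisms as isomorphisms of first-order doctrines *)

Section NaturalIso.
Variables (d d' : Order.disp_t) (C : category_fp).
Variables (P : fo_doctrine d C) (R : fo_doctrine d' C).
Variables (f : forall X, boolHom (P X) (R X)) (g : forall X, boolHom (R X) (P X)).
Hypotheses (fK : forall X, cancel (f X) (g X)).
Hypotheses (gK : forall X, cancel (g X) (f X)).
Hypothesis f_natural : forall (X Y : C) (h : hom X Y) (a : P Y),
  f X (dmap P h a) = dmap R h (f Y a).

Lemma inv_natural (X Y : C) (h : hom X Y) (a : R Y) :
  g X (dmap R h a) = dmap P h (g Y a).
Proof. by rewrite -{1}(gK a) -f_natural fK. Qed.

(** Right adjoints are unique: [z] lies below either side exactly when the reindexing of [g z] along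
    [pr1] lies below [a]. *)
Lemma natural_iso_fall (X Y : C) (a : P (X \x Y)) :
  f X (fall P a) = fall R (f (X \x Y) a).
Proof.
apply: eq_lower => z; rewrite -(boolHom_can_le (@fK _) (@gK _)) -!fall_adj.
by rewrite -inv_natural (boolHom_can_le (@fK _) (@gK _)).
Qed.

Lemma preserves_fp_id : preserves_fp (functor_id C).
Proof.
split=> [Z|X Y Z h k]; first by exists (bang Z); split=> // k _; exact/esym/bang_uniq.
exists (pairm h k); split; first by split; [exact: pr1_pair|exact: pr2_pair].
by move=> l [<- <-]; exact/esym/pair_uniq.
Qed.

Lemma natural_iso_fom_fall (X Y : C) (a : P (X \x Y)) (u : hom (X \x Y) (X \x Y)) :
  pr1 X Y \oc u = pr1 _ _ -> pr2 X Y \oc u = pr2 _ _ ->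
  f X (fall P a) = fall R (dmap R u (f (X \x Y) a)).
Proof.
(* Over the identity functor the comparison morphism can only be the identity. *)
move=> u1 u2; have -> : u = idm _.
  by rewrite (pair_uniq u) u1 u2 [RHS]pair_uniq !compm1.
by rewrite dmap1 natural_iso_fall.
Qed.

Definition fo_iso : fo_morphism P R :=
  @FoMorphism d d' C C P R
    (@DoctrineMorphism d d' C C P R (functor_id C) f f_natural)
    preserves_fp_id natural_iso_fom_fall.

End NaturalIso.

(* A composite of identity functors is [functor_id] only up to its proof fields. *)
Lemma doctrine_id_eq d (C : category_fp) (P : boolean_doctrine d C)
    (i1 : forall X : C, idm X = idm X)
    (iM : forall (X Y Z : C) (h : hom Y Z) (k : hom X Y), h \oc k = h \oc k)
    (n : forall X, boolHom (P X) (P X)) nat :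
  (forall X, n X =1 id) ->
  @DoctrineMorphism d d C C P P
    (@Functor C C id (fun _ _ h => h) i1 iM) n nat = doctrine_id P.
Proof.
move=> nE; rewrite /doctrine_id /functor_id.
have nE' : n = fun X => boolHom_id (P X).
  by apply: functional_extensionality_dep => X; apply: boolHom_eq.
rewrite (Prop_irrelevance i1 (fun=> erefl)) in nat *.
rewrite (Prop_irrelevance iM (fun _ _ _ _ _ => erefl)) in nat *.
by move: nat; rewrite nE' => nat; congr DoctrineMorphism; exact: Prop_irrelevance.
Qed.

Lemma fo_isoP d d' (C : category_fp) (P : fo_doctrine d C) (R : fo_doctrine d' C)
    f g fK gK nat :
  is_fo_isomorphism (@fo_iso d d' C P R f g fK gK nat).
Proof.
exists (fo_iso gK fK (inv_natural fK gK nat)); split.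
  by apply: doctrine_id_eq => X x; exact: fK.
by apply: doctrine_id_eq => X x; exact: gK.
Qed.

(** * Interpretation of formulas in the doctrine *)

Section Interpretation.
Variables (F : language) (d : Order.disp_t) (P : fo_doctrine d (Ctx F)).
Variable P0 : forall X : Ctx F, set (P X).

Definition qf_language : language :=
  @Language {X : ctx & {a : P X | P0 a}} (fun p => size (tag p)).
Local Notation R := qf_language.

Definition ctx1 : ctx := @MkCtx [:: 0] isT.

Definition var0 : vars ctx1 := exist _ 0 isT.

Lemma vars_ctx1 (v : vars ctx1) : v = var0.
Proof. by apply: val_inj; have := valP v; rewrite inE => /eqP. Qed.

(** Contexts index variables by name, atoms index arguments by position; this map and [index_var]
    translate. *)
Definition var_index (s : seq nat) (v : vars s) : 'I_(size s) :=
  Ordinal (etrans (index_mem (val v) s) (valP v)).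

Definition index_var (s : seq nat) (i : 'I_(size s)) : vars s :=
  exist _ (nth 0 s i) (mem_nth 0 (ltn_ord i)).

Lemma var_indexK (s : seq nat) : cancel (@var_index s) (@index_var s).
Proof. by move=> v; apply: val_inj; rewrite /= nth_index ?(valP v). Qed.

(** Semantic counterpart of [slift], landing in a genuine context instead of an [option] type. *)
Definition up (V : Type) (c : ctx) (s : V -> cterm F c) (o : option V) :
    cterm F (ctx_prod c ctx1) :=
  if o is Some v then tsubst (@ctx_pr1 F c ctx1) (s v) else Var (pinr c var0).

(* A formula is evaluated along a substitution into a context [c], because the
   body of a quantifier has its variables in [option V], which is not a context. *)
Fixpoint interp (V : Type) (a : form F R V) : forall c : Ctx F, (V -> cterm F c) -> P c :=
  match a with
  | Atom p ts => fun c s =>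
      dmap P (fun v => tsubst s (ts (var_index v)) : cterm F c)
        (sval (tagged p))
  | Top => fun _ _ => \top%O
  | Bot => fun _ _ => \bot%O
  | And a b => fun _ s => (interp a s `&` interp b s)%O
  | Or a b => fun _ s => (interp a s `|` interp b s)%O
  | Imp a b => fun _ s => (~` interp a s `|` interp b s)%O
  | Not a => fun _ s => (~` interp a s)%O
  | All a => fun c s => fall P (X := c) (Y := ctx1) (interp a (up s))
  | Ex a => fun c s =>
      (~` fall P (X := c) (Y := ctx1) (~` interp a (up s)))%O
  end.

Arguments interp {V} a {c} s.

Lemma interp_dmap V (a : form F R V) (c c' : Ctx F) (f : hom c' c)
    (s : V -> cterm F c) :
  dmap P f (interp a s) = interp a (fun v => tsubst f (s v) : cterm F c').
Proof.
elim: V / a c c' f s => [V p ts|V|V|V a IHa b IHb|V a IHa b IHb|V a IHa b IHb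
  |V a IHa|V a IHa|V a IHa] c c' f s /=;
  rewrite ?(bhomI, bhomU, bhom0, bhom1, bhomC) ?IHa ?IHb //.
- rewrite -dmapM; congr (dmap P _ _); apply/funext => v /=.
  by rewrite /ctx_comp tsubst_tsubst.
(* Beck-Chevalley moves [f] under the quantifier; it remains to see that [prod_id] of [f] carries
   [up s] to [up] of the reindexed environment. *)
- rewrite fall_BC IHa; congr (fall P (interp _ _)).
  apply/funext => -[v|] /=; last by rewrite /ctx_pair psplit_inr.
  rewrite !tsubst_tsubst; congr tsubst; apply/funext => w /=.
  by rewrite /ctx_pair psplit_inl.
- rewrite fall_BC bhomC IHa; congr (~` fall P (~` interp _ _))%O.
  apply/funext => -[v|] /=; last by rewrite /ctx_pair psplit_inr.
  rewrite !tsubst_tsubst; congr tsubst; apply/funext => w /=.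
  by rewrite /ctx_pair psplit_inl.
Qed.

Lemma interp_env (c c' : ctx) (a : cform F R c) (s : vars c -> cterm F c') :
  interp a (c := c') s = dmap P (s : hom (c' : Ctx F) (c : Ctx F)) (interp a Var).
Proof. by rewrite interp_dmap. Qed.

Lemma interp_fsubst V W (r : V -> term F W) (a : form F R V) (c : Ctx F)
    (s : W -> cterm F c) :
  interp (fsubst r a) s = interp a (fun v => tsubst s (r v)).
Proof.
have upE (U U' : Type) (q : U -> term F U') (e : Ctx F) (t : U' -> cterm F e) :
    (fun o => tsubst (up t) (slift q o)) = up (fun v => tsubst t (q v)).
  by apply/funext => -[v|] //=; rewrite !tsubst_tsubst.
elim: V / a W r c s => [V p ts|V|V|V a IHa b IHb|V a IHa b IHb|V a IHa b IHb
  |V a IHa|V a IHa|V a IHa] W r c s /=; rewrite ?IHa ?IHb ?upE //.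
by congr (dmap P _ _); apply/funext => v; rewrite tsubst_tsubst.
Qed.

(** * The theory and soundness *)

Definition qf_theory : theory F R :=
  [set a | @interp _ a ctx0 Var = \top%O].

(** The graph of [t], a section of the first projection. *)
Definition inst1 (c : ctx) (t : cterm F c) : ctx_hom F c (ctx_prod c ctx1) :=
  @ctx_pair F c ctx1 c Var (fun=> t).

(** Transposing gives an inequality over the product; pulling back along the section [inst1 t]
    cancels the projection. *)
Lemma fall_inst (c : Ctx F) (t : cterm F c) (a : P (c \x (ctx1 : Ctx F))) (x : P c) :
  (x <= fall P a)%O -> (x <= dmap P (inst1 t : hom c (c \x (ctx1 : Ctx F))) a)%O.
Proof.
rewrite -fall_adj => /(boolHom_le (dmap P (inst1 t : hom c (c \x (ctx1 : Ctx F))))).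
by rewrite -dmapM [_ \oc _](@pr1_pair (Ctx F)) dmap1.
Qed.

Lemma interp_inst_x (c : ctx) x (xc : x \notin (c : seq nat))
    (a : cform F R (ext xc)) (t : cterm F c) (c' : Ctx F) (s : vars c -> cterm F c') :
  interp (inst_x t a) s =
  dmap P (inst1 (tsubst s t) : hom c' (c' \x (ctx1 : Ctx F)))
    (interp (frename (@vbind c _) a) (up s)).
Proof.
rewrite !interp_fsubst interp_dmap; congr interp; apply/funext => v /=.
case: (vbind c v) => [w|] /=; last by rewrite /inst1 /ctx_pair psplit_inr.
rewrite tsubst_tsubst -[LHS]tsubst_var; congr tsubst; apply/funext => u /=.
by rewrite /inst1 /ctx_pair psplit_inl.
Qed.

(* Quantifying over all environments, and over arbitrary bounds instead of finite
   meets and joins, makes the structural rules and context enlargement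
   immediate. *)
Definition valid (c : ctx) (G D : seq (cform F R c)) : Prop :=
  forall (c' : Ctx F) (s : vars c -> cterm F c') (x y : P c'),
    (forall a, a \in G -> (x <= interp a s)%O) ->
    (forall b, b \in D -> (interp b s <= y)%O) -> (x <= y)%O.

Lemma interp_weaken (c : ctx) (x : nat) (a : cform F R c) (c' : Ctx F)
    (s : vars (rcons c x) -> cterm F c') :
  interp (weaken x a) s = interp a (fun v => s (vincl x v)).
Proof. exact: interp_fsubst. Qed.

(** Puts the side formulas of a quantifier rule in the form that [fall_adj] transposes. *)
Lemma interp_weaken_up (c : ctx) (x : nat) (a : cform F R c) (c' : Ctx F)
    (s : vars c -> cterm F c') :
  interp (weaken x a) (fun v => up s (vbind c v)) =
  dmap P (pr1 c' (ctx1 : Ctx F)) (interp a s).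
Proof.
rewrite interp_weaken interp_dmap; congr interp; apply/funext => v.
by rewrite vbind_incl.
Qed.

Lemma valid_sub (c : ctx) (G G' D D' : seq (cform F R c)) :
  {subset G <= G'} -> {subset D <= D'} -> valid G D -> valid G' D'.
Proof.
move=> sG sD H c' s x y xG Dy; apply: (H c' s) => b bI.
  exact/xG/sG.
exact/Dy/sD.
Qed.

Lemma qf_theory_sound (c : ctx) (G D : seq (cform F R c)) :
  provable qf_theory c G D -> valid G D.
Proof.
move=> H; elim: c G D / H.
- move=> a Ta c s x y _ /forall_in_cons[ay _]; apply: le_trans ay.
  by rewrite interp_env [interp a Var]Ta bhom1 lex1.
- by move=> c a c' s x y /forall_in_cons[xa _] /forall_in_cons[/(le_trans xa)].
- by move=> c G D a _; apply: valid_sub => b // bG; rewrite inE bG orbT.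
- by move=> c G D a _; apply: valid_sub => b // bG; rewrite mem_rcons inE bG orbT.
- by move=> c G D a _; apply: valid_sub => b //; rewrite !inE orbA orbb.
- by move=> c G D a _; apply: valid_sub => b //; rewrite !(mem_rcons, inE) orbA orbb.
- move=> c G G' D a b _; apply: valid_sub => e //.
  by rewrite !mem_cat !inE [(e == a) || _]orbCA.
- move=> c G D D' a b _; apply: valid_sub => e //.
  by rewrite !mem_cat !inE [(e == a) || _]orbCA.
- move=> c G G' D D' a _ IH _ IH' c' s x y /forall_in_cat[xG xG'].
  move=> /forall_in_cat[Dy D'y]; apply: (le_cut (z := interp a s)).
    apply: (IH c' s) => //; apply/forall_in_rcons; split=> [|b bD].
      exact: leUr.
    by rewrite lexU2 // Dy.
  apply: (IH' c' s) => //; apply/forall_in_cons; split=> [|b bG].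
    exact: leIr.
  by rewrite leIx2 // xG'.
- by move=> c G D _; apply: valid_sub => b // bG; rewrite inE bG orbT.
- by move=> c G D c' s x y _ /forall_in_rcons[/(le_trans (lex1 _))].
- by move=> c G D c' s x y /forall_in_cons[/le_trans H _] _; apply/H/le0x.
- by move=> c G D _; apply: valid_sub => b // bG; rewrite mem_rcons inE bG orbT.
- move=> c G D a b _ IH c' s x y /forall_in_cons[/=].
  by rewrite lexI => /andP[xa xb] xG; apply: IH; apply/forall_in_cons.
- move=> c G D a b _ IH c' s x y /forall_in_cons[/=].
  by rewrite lexI => /andP[xa xb] xG; apply: IH; apply/forall_in_cons.
- move=> c G D a b _ IH _ IH' c' s x y xG /forall_in_rcons[/= aby Dy].
  apply: (le_cut (z := interp a s)).
    apply: (IH c' s) => //; apply/forall_in_rcons; split=> [|e eD].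
      exact: leUr.
    by rewrite lexU2 // Dy.
  apply: (le_cut (z := interp b s)).
    apply: (IH' c' s) => [e eG|]; first by rewrite leIx2 // xG.
    apply/forall_in_rcons; split=> [|e eD]; first exact: leUr.
    by rewrite lexU2 // Dy.
  by apply: le_trans aby; rewrite leI2 // leIr.
- move=> c G D a b _ IH _ IH' c' s x y /forall_in_cons[/= xab xG] Dy.
  (* Cuts on [b] and then on [a] reduce the rule to its two premises and an inequality that follows
     from [xab]. *)
  apply: (le_cut (z := interp b s)); last first.
    apply: (IH' c' s) => //; apply/forall_in_cons; split=> [|e eG].
      exact: leIr.
    by rewrite leIx2 // xG.
  apply: (le_cut (z := interp a s)).
    by apply: le_trans xab _; rewrite joinC -joinA leUr.
  apply: (IH c' s) => [|e eD]; last by rewrite lexU2 // Dy.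
  apply/forall_in_cons; split=> [|e eG]; first exact: leIr.
  by rewrite leIx2 // xG.
- move=> c G D a b _ IH c' s x y xG /forall_in_rcons[/=].
  by rewrite leUx => /andP[ay yb] Dy; apply: IH xG _; apply/forall_in_rcons.
- move=> c G D a b _ IH c' s x y xG /forall_in_rcons[/=].
  by rewrite leUx => /andP[ay yb] Dy; apply: IH xG _; apply/forall_in_rcons.
- move=> c G D a _ IH c' s x y /forall_in_cons[/= xa xG] Dy.
  apply: (le_cut (z := interp a s)).
    apply: (IH c' s) => //; apply/forall_in_rcons; split=> [|e eD].
      exact: leUr.
    by rewrite lexU2 // Dy.
  by rewrite (le_trans (leI2 xa (lexx _))) // meetC meetxC le0x.
- move=> c G D a _ IH c' s x y xG /forall_in_rcons[/= ay Dy].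
  apply: (le_cut (z := interp a s)).
    by rewrite joinC -leI_compl (le_trans (leIr _ _)).
  apply: (IH c' s) => //; apply/forall_in_cons; split=> [|e eG].
    exact: leIr.
  by rewrite leIx2 // xG.
- move=> c G D a b _ IH _ IH' c' s x y /forall_in_cons[/= xab xG] Dy.
  apply: (le_cut (z := interp a s)).
    apply: (IH c' s) => //; apply/forall_in_rcons; split=> [|e eD].
      exact: leUr.
    by rewrite lexU2 // Dy.
  apply: (IH' c' s) => //; apply/forall_in_cons; split=> [|e eG].
    rewrite (le_trans (leI2 xab (lexx _))) // meetUl leUx leIl.
    by rewrite meetC meetxC le0x.
  by rewrite leIx2 // xG.
- move=> c G D a b _ IH c' s x y xG /forall_in_rcons[/=].
  rewrite leUx => /andP[ay yb] Dy; apply: (le_cut (z := interp a s)).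
    by rewrite joinC -leI_compl (le_trans (leIr _ _)).
  apply: (IH c' s) => [|]; last exact/forall_in_rcons.
  apply/forall_in_cons; split=> [|e eG]; first exact: leIr.
  by rewrite leIx2 // xG.
- move=> c x xc G D _ IH c' s u y uG Dy.
  apply: (IH c' (fun v => s (vincl x v))) => b bI; rewrite -interp_weaken.
    by apply: uG; rewrite map_f.
  by apply: Dy; rewrite map_f.
- move=> c x xc G D a t _ IH c' s u y /forall_in_cons[/= ua uG] Dy.
  apply: (IH c' s) => //; apply/forall_in_cons; split=> //.
  by rewrite interp_inst_x; exact: fall_inst.
- move=> c x xc G D a _ IH c' s u y uG /forall_in_rcons[/= ay Dy].
  set z := fall P _ in ay; apply: (le_cut (z := z)).
    (* The bound [y] moves to the left as a complement so that [fall_adj] applies, then moves back;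
       the result is the premise over the product with [ctx1]. *)
    rewrite -leI_compl /z -fall_adj bhomI bhomC leI_compl /frename interp_fsubst.
    apply: (IH _ (fun v => up s (vbind c v))) => [_ /mapP[b bG ->]|].
      by rewrite interp_weaken_up boolHom_le // uG.
    apply/forall_in_rcons; split=> [|_ /mapP[b bD ->]]; first exact: leUr.
    by rewrite interp_weaken_up lexU2 // boolHom_le // Dy.
  exact: le_trans (leIr _ _) ay.
- move=> c x xc G D a _ IH c' s u y /forall_in_cons[/= ua uG] Dy.
  set z := fall P _ in ua; apply: (le_cut (z := z)); last first.
    by rewrite (le_trans (leI2 ua (lexx z))) // meetC meetxC le0x.
  (* Same transposition as for [All], but [z] quantifies the complement of [a], so [a] ends up as a
     hypothesis. *)
  rewrite -leI_compl /z -fall_adj bhomI bhomC leI_compl joinC -leI_compl complK.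
  rewrite /frename interp_fsubst.
  apply: (IH _ (fun v => up s (vbind c v))) => [|_ /mapP[b bD ->]]; last first.
    by rewrite interp_weaken_up boolHom_le // Dy.
  apply/forall_in_cons; split=> [|_ /mapP[b bG ->]]; first exact: leIr.
  by rewrite interp_weaken_up leIx2 // boolHom_le // uG.
- move=> c x xc G D a t _ IH c' s u y uG /forall_in_rcons[/= ay Dy].
  apply: (IH c' s) => //; apply/forall_in_rcons; split=> //.
  (* By contraposition this is an instance of the universal quantifier applied to the complement. *)
  apply: le_trans ay; rewrite lexC interp_inst_x -bhomC.
  exact: fall_inst.
Qed.

(** * Completeness *)

Lemma fall_top (X Y : Ctx F) : fall P (\top%O : P (X \x Y)) = \top%O.
Proof. by apply/eqP; rewrite -le1x -fall_adj lex1. Qed.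

(** Quantifying away the last variable keeps the value at top, so the universal closure is an axiom;
    enlarging the context again recovers the formula. *)
Lemma qf_theory_complete (c : ctx) (a : cform F R c) :
  interp a (c := c) Var = \top%O -> provable qf_theory c [::] [:: a].
Proof.
case: c a => n cu; rewrite /=.
elim/last_ind: n cu => [|n x IH] cu a.
  by rewrite (bool_irrelevance cu isT); exact: Pr_axiom.
have xn : x \notin n by move: cu; rewrite rcons_uniq => /andP[].
have nu : uniq n by move: cu; rewrite rcons_uniq => /andP[].
pose c := MkCtx nu; have xnc : x \notin (c : seq nat) := xn.
rewrite (bool_irrelevance cu (ext_uniq xnc)) => a1.
have all1 : interp (forall_x (xc := xnc) a) (c := c) Var = \top%O.
  rewrite -[RHS](@fall_top (c : Ctx F) (ctx1 : Ctx F)) /=; congr fall.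
  by rewrite /frename interp_fsubst (@interp_env (ext xnc)) a1 bhom1.
have H := Pr_enlarge xnc (IH nu _ all1).
apply: (@Pr_cut _ _ _ (ext xnc) [::] [::] [::] [:: a] _ H).
(* What remains, deriving [a] from its weakened universal closure, transposes to an identity
   sequent. *)
rewrite -{2}(body_vbind (xc := xnc) a).
exact/prv_all_adj/Pr_id.
Qed.

(** An inequality says that the implication has value top, so completeness for single formulas
    suffices; the converse is soundness at the environment [Var]. *)
Lemma interp_le (c : ctx) (a b : cform F R c) :
  (interp a (c := c) Var <= interp b (c := c) Var)%O <->
  provable qf_theory c [:: a] [:: b].
Proof.
split=> [ab|/qf_theory_sound H]; last first.
  by apply: (H c Var) => e; rewrite inE => /eqP ->.
have /qf_theory_complete H : interp (Imp a b) (c := c) Var = \top%O.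
  by apply/le_anti; rewrite lex1 /= -leI_compl complK meet1x.
apply: (@Pr_cut _ _ _ c [::] [:: a] [::] [:: b] _ H).
apply: Pr_impL; last by apply: (@prv_ax _ _ _ _ _ _ b); rewrite inE eqxx.
by apply: (@prv_ax _ _ _ _ _ _ a); rewrite ?mem_rcons inE eqxx.
Qed.

(** * Blocks of quantifiers *)

(** Reindexing along [q] undoes reindexing along the split epimorphism [r]. *)
Lemma dmap_retract_le (X Y : Ctx F) (r : hom Y X) (q : hom X Y) (x y : P X) :
  r \oc q = idm X -> (dmap P r x <= dmap P r y)%O = (x <= y)%O.
Proof.
move=> rq; apply/idP/idP => [/(boolHom_le (dmap P q))|/boolHom_le //].
by rewrite -!dmapM rq !dmap1.
Qed.

(* The context [c'] is any one identified with [c] followed by [s], since the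
   induction on [s] turns (c \x [y]) \x s' into c \x (y :: s'), which are only
   isomorphic. *)
Lemma interp_alls (s : seq nat) V (b : form F R (V + vars s)) (c c' : Ctx F)
    (e : vars (c : ctx) + vars s -> vars (c' : ctx))
    (e' : vars (c' : ctx) -> vars (c : ctx) + vars s)
    (t : V -> cterm F c) (a : P c) :
  uniq s -> cancel e e' -> cancel e' e ->
  (a <= interp (alls b) t)%O =
  (dmap P ((fun v => Var (e (inl v))) : hom c' c) a <=
   interp b (fun v => match v with
     | inl u => tsubst (fun w => Var (e (inl w))) (t u)
     | inr w => Var (e (inr w)) end))%O.
Proof.
elim: s V b c c' e e' t a => [|y s IH] V b c c' e e' t a /= us eK e'K.
  (* With [s] empty, [e] identifies [c] with [c'], so both sides are compared over [c']. *)
  rewrite -(@dmap_retract_le _ _ ((fun v => Var (e (inl v))) : hom c' c)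
    ((fun v => Var (bind_nil (e' v))) : hom c c')).
    rewrite interp_dmap /frename interp_fsubst; congr (_ <= interp _ _)%O.
    by apply/funext => -[v|v] //; case: (vars_nilF v).
  by apply/funext => v; rewrite /= /ctx_comp /= eK.
have [ys {}us] := andP us.
(* The renamings [m] and [m'] match the variable of [ctx1] with [None], the bound variable [y]. *)
pose m (v : vars (ctx_prod c ctx1) + vars s) : option (vars (c : ctx)) + vars s :=
  match v with
  | inl u => inl (if psplit u is inl w then Some w else None)
  | inr w => inr w end.
pose m' (v : option (vars (c : ctx)) + vars s) : vars (ctx_prod c ctx1) + vars s :=
  match v with
  | inl (Some u) => inl (pinl ctx1 u)
  | inl None => inl (pinr c var0)
  | inr w => inr w end.
have mK : cancel m m'.
  case=> //= v; rewrite -{2}(psplitK v); case: (psplit v) => //= w.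
  by rewrite (vars_ctx1 w).
have m'K : cancel m' m by case=> [[v|]|v] //=; rewrite ?psplit_inl ?psplit_inr.
(* The adjunction removes the outer quantifier; the induction hypothesis then removes the block [s]
   over the base [ctx_prod c ctx1], with the same [c']. *)
rewrite -fall_adj.
rewrite (IH _ _ _ c' (fun v => e (unbind_hd y (m v)))
                   (fun v => m' (bind_hd (e' v)))) //; first last.
- by move=> v; rewrite m'K bind_hdK e'K.
- by move=> v; rewrite eK unbind_hdK // mK.
rewrite -dmapM /frename interp_fsubst; congr (_ <= _)%O.
  congr (dmap P _ a).
  by apply/funext => v /=; rewrite /ctx_comp /= psplit_inl.
congr interp; apply/funext => -[v|v] /=.
  rewrite tsubst_tsubst; congr tsubst; apply/funext => w /=.
  by rewrite psplit_inl.
have := bind_hdK (inr v : V + vars (y :: s)); rewrite /=.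
case: (vbind s v) => [w|] /= [<-] //.
by rewrite psplit_inr.
Qed.

(** Both sides have the same lower bounds, by [interp_alls] on the left and [fall_adj] on the
    right. *)
Lemma interp_fall (X Y : Ctx F) (b : cform F R (ctx_prod X Y)) :
  interp (alls (frename (@psplit X Y) b)) (c := X) Var =
  fall P (interp b (c := X \x Y) Var).
Proof.
apply: eq_lower => z; rewrite -fall_adj.
rewrite (@interp_alls Y _ _ X (X \x Y) (@punsplit X Y) (@psplit X Y)) ?names_uniq //;
  [|exact: punsplitK|exact: psplitK].
rewrite /frename interp_fsubst; congr (_ <= interp _ _)%O; apply/funext => v /=.
by rewrite -[in RHS](psplitK v); case: (psplit v).
Qed.

(** * Definable elements *)

Definition generic_atom (X : ctx) (a : P X) (Pa : P0 a) : cform F R X :=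
  @Atom F R (vars X) (existT _ X (exist _ a Pa)) (fun i => Var (index_var i)).

Lemma interp_generic_atom (X : ctx) (a : P X) (Pa : P0 a) :
  interp (generic_atom Pa) (c := X) Var = a.
Proof.
rewrite /= -[RHS]dmap1; congr (dmap P _ _); apply/funext => v.
by rewrite var_indexK.
Qed.

Lemma interp_subalgebra (X : ctx) :
  boolean_subalgebra (range (fun b : cform F R X => interp b (c := X) Var)).
Proof.
split.
- by exists Bot.
- by exists Top.
- by move=> _ _ [a _ <-] [b _ <-]; exists (And a b).
- by move=> _ _ [a _ <-] [b _ <-]; exists (Or a b).
- by move=> _ [a _ <-]; exists (Not a).
Qed.

Lemma stratum_interp n (X : Ctx F) (a : P X) :
  qa_stratum P0 n X a -> exists b : cform F R X, interp b (c := X) Var = a.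
Proof.
elim: n X a => [|n IH] X a.
  by move=> /= Pa; exists (generic_atom Pa); exact: interp_generic_atom.
(* Membership in [smallest] is instantiated at the subalgebra of definable elements, which leaves
   only the generators to check. *)
move=> /(_ _ (conj (interp_subalgebra X) _))[|b _ <-]; last by exists b.
move=> _ [Y _ [_ /IH[b <-] <-]].
by exists (alls (frename (@psplit X Y) b)); rewrite ?interp_fall.
Qed.

Hypothesis P0_qf : qf_fragment P0.

Lemma interp_surj (X : Ctx F) (a : P X) :
  exists b : cform F R X, interp b (c := X) Var = a.
Proof.
have : [set: P X] a by [].
by rewrite (qff_cover P0_qf) => -[n _ /stratum_interp].
Qed.

Lemma interp_qfree V (b : form F R V) (c : Ctx F) (s : V -> cterm F c) :
  qfree b -> P0 (interp b s).
Proof.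
have [S0 S1 SI SU SC] := qff_subalg P0_qf c.
elim: V / b s => //= [V p ts|V a IHa b IHb|V a IHa b IHb|V a IHa b IHb|V a IHa] s.
(* The value of an atom is a reindexing of an element of [P0]. *)
- by move=> _; apply: qff_reindex => //; exact: (svalP (tagged p)).
- by case/andP=> /IHa ? /IHb ?; apply: SI.
- by case/andP=> /IHa ? /IHb ?; apply: SU.
- by case/andP=> /IHa ? /IHb ?; apply: SU => //; apply: SC.
- by move=> /IHa ?; apply: SC.
Qed.

(** * The isomorphism with the syntactic doctrine *)

(** An arbitrary choice; by [interp_le] any two choices are provably equivalent, hence have the same
    class. *)
Definition formula_of (X : Ctx F) (a : P X) : cform F R X :=
  sval (cid (interp_surj a)).

Lemma formula_ofK (X : Ctx F) (a : P X) :
  interp (formula_of a) (c := X) Var = a.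
Proof. exact: (svalP (cid (interp_surj a))). Qed.

Local Notation L := (LT qf_theory).

Definition to_doctrine (X : Ctx F) (q : L X) : P X := interp (rep q) (c := X) Var.

Lemma to_doctrine_cls (X : Ctx F) (a : cform F R X) :
  to_doctrine (cls qf_theory a : L X) = interp a (c := X) Var.
Proof.
have [H H'] := rep_cls qf_theory a.
by apply/le_anti/andP; split; apply/interp_le.
Qed.

Definition to_LT (X : Ctx F) (a : P X) : L X := cls qf_theory (formula_of a).

Lemma to_LTK (X : Ctx F) : cancel (@to_LT X) (@to_doctrine X).
Proof. by move=> a; rewrite to_doctrine_cls formula_ofK. Qed.

Lemma to_LT_interp (X : Ctx F) (a : cform F R X) :
  to_LT (interp a (c := X) Var) = cls qf_theory a.
Proof. by apply/cls_eqP; rewrite -!interp_le formula_ofK. Qed.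

Lemma to_doctrineK (X : Ctx F) : cancel (@to_doctrine X) (@to_LT X).
Proof. by move=> q; rewrite to_LT_interp repK. Qed.

Fact to_doctrineI X : Order.meet_morphism (@to_doctrine X).
Proof.
by move=> p q; rewrite -(repK p) -(repK q) -cls_and !to_doctrine_cls.
Qed.

Fact to_doctrineU X : Order.join_morphism (@to_doctrine X).
Proof.
by move=> p q; rewrite -(repK p) -(repK q) -cls_or !to_doctrine_cls.
Qed.

Fact to_doctrine0 X : to_doctrine (\bot%O : L X) = \bot%O.
Proof. by rewrite -[\bot%O in LHS]cls_bot to_doctrine_cls. Qed.

Fact to_doctrine1 X : to_doctrine (\top%O : L X) = \top%O.
Proof. by rewrite -[\top%O in LHS]cls_top to_doctrine_cls. Qed.

Fact to_doctrineC X : {morph @to_doctrine X : q / (~` q)%O}.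
Proof. by move=> q; rewrite -(repK q) -cls_not !to_doctrine_cls. Qed.

Definition to_doctrine_hom X : boolHom (L X) (P X) :=
  BoolHom (@to_doctrineI X) (@to_doctrineU X) (to_doctrine0 X) (to_doctrine1 X)
    (@to_doctrineC X).

(** The homomorphism laws are checked for [to_doctrine], which computes on classes, and transported
    to the inverse. *)
Definition to_LT_hom X : boolHom (P X) (L X) :=
  boolHom_inv (f := to_doctrine_hom X) (@to_doctrineK X) (@to_LTK X).

Fact to_LT_natural (X Y : Ctx F) (h : hom X Y) (a : P Y) :
  to_LT_hom X (dmap P h a) = dmap L h (to_LT_hom Y a).
Proof.
rewrite -(formula_ofK a) interp_dmap /= to_LT_interp LTmap_cls -to_LT_interp.
congr to_LT; rewrite interp_fsubst; congr interp; apply/funext => v.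
by rewrite tsubst_var.
Qed.

Definition LT_iso : fo_morphism P L :=
  fo_iso (f := to_LT_hom) (g := to_doctrine_hom) to_LTK to_doctrineK to_LT_natural.

Lemma LT_iso_qf (X : Ctx F) : LT_iso X @` P0 (X := X) = LT0 qf_theory X.
Proof.
apply/seteqP; split=> [_ [a Pa <-]|_ [b qb <-]].
  (* An element of [P0] is the value of its own atom, which is quantifier-free. *)
  exists (generic_atom Pa) => //=; rewrite -to_LT_interp; congr to_LT.
  exact: interp_generic_atom.
by exists (interp b (c := X) Var); [exact: interp_qfree|exact: to_LT_interp].
Qed.

End Interpretation.

Theorem theorem3p9 (F : language) (d : Order.disp_t)
    (P : fo_doctrine d (Ctx F)) (P0 : forall X : Ctx F, set (P X)) :
  qf_fragment P0 ->
  exists (R : language) (T : theory F R) (m : fo_morphism P (LT T)),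
    is_fo_isomorphism m /\
    forall X : Ctx F, m X @` P0 X = LT0 T (dm_fun m X).
Proof.
move=> P0_qf; exists (qf_language P0), (@qf_theory F d P P0), (LT_iso P0_qf).
by split; [exact: fo_isoP|move=> X; exact: LT_iso_qf].
Qed.
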